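(* Let $G$ be a disjoint hypergraph, i.e. a hypergraph whose hyperedges of size at least $4$ are pairwise disjoint. Then $G$ is unimodular if and only if $G$ contains neither an odd cycle nor a tree house.
   Context: A hypergraph $G=(V,E)$ consists of a finite set $V=V(G)$ of vertices and a finite multiset $E=E(G)$ of non-empty subsets of $V$, called hyperedges (different copies of the same subset are distinguished). Its incidence matrix $M(G)\in\{0,1\}^{V\times E}$ has $M(G)_{v,e}=1$ if and only if $v\in e$. A matrix is totally unimodular (TU) if every square submatrix has determinant in $\{0,\pm1\}$; $G$ is unimodular if $M(G)$ is TU. A graph is a hypergraph all of whose hyperedges have size exactly $2$ (parallel edges allowed). Paths and cycles are the usual graph notions (a path has no repeated vertices), viewed as hypergraphs; a path or cycle is odd if it has an odd number of edges. A hypergraph $H$ with $V(H)\subseteq V(G)$ is a partial subhypergraph of $G$ if there is an injection $\iota\colon E(H)\to E(G)$ with $f=\iota(f)\cap V(H)$ for every $f\in E(H)$. $G$ contains $H$ if $H$ is isomorphic to a partial subhypergraph of $G$. A tree house is a hypergraph $T=(V,E\cup\{h\})$ such that: (T1) $h=\{r,\ell_1,\ell_2,\ell_3\}$ has size $4$; (T2) $(V,E)$ is a tree consisting of three odd paths $P_1,P_2,P_3$; (T3) the endpoints of $P_i$ are $r$ and $\ell_i$, and the vertex sets $V(P_i)\setminus\{r\}$, $i\in\{1,2,3\}$, are pairwise disjoint. *)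

(* Defs.v *)
From mathcomp Require Import all_boot all_algebra.

Set Implicit Arguments.
Unset Strict Implicit.
Unset Printing Implicit Defensive.

(* [V] is the whole vertex set. Hyperedges are indexed by a finite type, so
   that distinct indices may carry the same subset of [V] (multiset). *)
Record hypergraph (V : finType) := Hypergraph {
  hyperedge : finType;
  vset : hyperedge -> {set V};
  vset_neq0 : forall e, vset e != set0
}.

Arguments vset {V h} e.

Definition incidence_mx (V : finType) (G : hypergraph V) :
    'M[int]_(#|V|, #|hyperedge G|) :=
  \matrix_(i, j) ((enum_val i \in vset (enum_val j))%:R)%R.

Definition totally_unimodular (m n : nat) (A : 'M[int]_(m, n)) : Prop :=
  forall (k : nat) (f : 'I_k -> 'I_m) (g : 'I_k -> 'I_n),
    injective f -> injective g ->
    (\det (mxsub f g A) \in [:: 0; 1; -1])%R.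

Definition unimodular (V : finType) (G : hypergraph V) : Prop :=
  totally_unimodular (incidence_mx G).

Definition disjoint_hypergraph (V : finType) (G : hypergraph V) : Prop :=
  forall e f : hyperedge G, e != f -> 4 <= #|vset e| -> 4 <= #|vset f| ->
    [disjoint vset e & vset f].

Definition hyp_iso (V V' : finType) (H : hypergraph V) (H' : hypergraph V') :
    Prop :=
  exists (phi : V -> V') (psi : hyperedge H -> hyperedge H'),
    [/\ bijective phi, bijective psi &
        forall f, vset (psi f) = phi @: vset f].

(* The condition V(H) \subseteq V(G) is rendered by taking for V(H) the
   subtype of V(G) given by a set [W] of vertices. *)
Definition partial_subhypergraph (V : finType) (W : {set V})
    (H : hypergraph {x : V | x \in W}) (G : hypergraph V) : Prop :=
  exists2 iota : hyperedge H -> hyperedge G,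
    injective iota & forall f, val @: vset f = vset (iota f) :&: W.

Definition contains (V V' : finType) (G : hypergraph V) (H : hypergraph V') :
    Prop :=
  exists (W : {set V}) (H' : hypergraph {x : V | x \in W}),
    partial_subhypergraph H' G /\ hyp_iso H H'.

Definition is_graph (V : finType) (G : hypergraph V) : Prop :=
  forall e : hyperedge G, #|vset e| = 2.

(* [ordS] is the cyclic successor on ['I_n]. For [n = 2] this is a pair of
   parallel edges. *)
Definition is_cycle (n : nat) (V : finType) (C : hypergraph V) : Prop :=
  1 < n /\
  exists (v : 'I_n -> V) (e : 'I_n -> hyperedge C),
    [/\ bijective v, bijective e & forall i, vset (e i) = [set v i; v (ordS i)]].

Definition is_odd_cycle (V : finType) (C : hypergraph V) : Prop :=
  exists2 n, odd n & is_cycle n C.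

(* A path of [G] with [n] edges, from [x] to [y]: its vertices [v 0, .., v n]
   and its edges [e 0, .., e (n - 1)]. *)
Definition is_path (V : finType) (G : hypergraph V) (x y : V) (n : nat)
    (v : 'I_n.+1 -> V) (e : 'I_n -> hyperedge G) : Prop :=
  [/\ injective v, v ord0 = x, v ord_max = y &
      forall i : 'I_n,
        vset (e i) = [set v (widen_ord (leqnSn n) i); v (lift ord0 i)]].

Definition adjacent (V : finType) (G : hypergraph V) : rel V :=
  fun x y => [exists e : hyperedge G, (x \in vset e) && (y \in vset e)].

Definition is_tree (V : finType) (G : hypergraph V) : Prop :=
  [/\ is_graph G,
      0 < #|V|,
      forall x y, connect (adjacent G) x y &
      forall (n : nat) (V' : finType) (C : hypergraph V'),
        is_cycle n C -> ~ contains G C].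

Definition del_vset (V : finType) (T : hypergraph V) (h : hyperedge T)
    (e : {e : hyperedge T | e != h}) : {set V} := vset (val e).

Fact del_vset_neq0 (V : finType) (T : hypergraph V) (h : hyperedge T)
    (e : {e : hyperedge T | e != h}) : del_vset e != set0.
Proof. exact: vset_neq0. Qed.

Definition del_hyperedge (V : finType) (T : hypergraph V) (h : hyperedge T) :
    hypergraph V :=
  Hypergraph (@del_vset_neq0 V T h).

(* The graph (V, E) of a tree house (V, E + h) is [del_hyperedge h]; it
   "consists of" the three paths if every vertex and every edge lies on one of
   them. *)
Definition is_tree_house (V : finType) (T : hypergraph V) : Prop :=
  exists (h : hyperedge T) (r : V) (l : 'I_3 -> V) (n : 'I_3 -> nat)
         (v : forall i, 'I_(n i).+1 -> V)
         (e : forall i, 'I_(n i) -> hyperedge (del_hyperedge h)),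
    [/\ vset h = r |: [set l i | i : 'I_3] /\ #|vset h| = 4,
        is_tree (del_hyperedge h),
        forall i, odd (n i) /\ is_path r (l i) (v i) (e i),
        (forall x : V, exists i k, x = v i k) /\
        (forall g : hyperedge (del_hyperedge h), exists i k, g = e i k) &
        forall i j, i != j ->
          [disjoint [set v i k | k in 'I_(n i).+1] :\ r
                  & [set v j k | k in 'I_(n j).+1] :\ r]].

Definition contains_odd_cycle (V : finType) (G : hypergraph V) : Prop :=
  exists (V' : finType) (C : hypergraph V'), is_odd_cycle C /\ contains G C.

Definition contains_tree_house (V : finType) (G : hypergraph V) : Prop :=
  exists (V' : finType) (T : hypergraph V'), is_tree_house T /\ contains G T.

(* Main.v *)
(* Suppose that G is not unimodular, and let M be a square submatrix of its
   incidence matrix of least order with determinant outside {0, 1, -1}. By an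
   argument of Camion, all entries of the adjugate of M are 1 or -1 and
   |det M| = 2; hence all row and column sums of M are even, while the sum of
   all entries is 2 modulo 4. So the bipartite incidence graph of M has even
   degrees and its degree sum is 4 modulo 8. It remains to show that a bipartite
   graph with even degrees, in which no vertex lies in two hyperedges of degree
   greater than 3, has a degree sum divisible by 8, unless it has an odd hole (a
   chordless cycle of length 2 modulo 4) or an induced tree house.

   This goes by induction on the number of edges. Split the edges into cycles.
   If all have length 0 modulo 4, the claim is clear. Otherwise consider a
   shortest cycle of length 2 modulo 4: it has a chord, from a hub h, that is, a
   hyperedge of degree greater than 3. Let D range over the components of the
   graph without h and its neighbours, and let O(D) be the set of neighbours of
   h with an odd number of neighbours in D. The part of D consists of the edges
   meeting D and of those between h and O(D); odd holes and tree houses of a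
   part come from the whole graph.
   - If each neighbour of h lies in exactly one O(D), then the degree sum is the
     sum of those of the parts. The chord shows that these are proper subgraphs,
     so induction applies to them.
   - If O(D) = O(D') is not empty for some D <> D', then induction applies to
     the graph of the edges meeting D or D', and to the graph of the others.
   - Otherwise some neighbour t of h lies in O(D) for three different D, and
     paths from t through these D to three further neighbours of h make a tree
     house with hub h.

   Conversely, the incidence matrix of an odd cycle or a tree house is square
   with even column sums and trivial left kernel, so its determinant is neither
   1 or -1, nor 0. *)

Require Import Defs.
From mathcomp Require Import all_boot.
From mathcomp Require Import all_order all_algebra zify.
Import Order.TTheory GRing.Theory Num.Theory.

Set Implicit Arguments.
Unset Strict Implicit.
Unset Printing Implicit Defensive.

(** * Induced paths and chordless cycles *)

Section InducedPaths.

Variables (N : eqType) (adj : rel N).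

(** In graph terms, [anti s t] makes [s] and [t] disjoint and anticomplete; [anti1] is the case of a
    single node. *)
Definition anti1 (x : N) : seq N -> bool :=
  all (fun y => (x != y) && ~~ adj x y).

Definition anti : seq N -> seq N -> bool :=
  allrel (fun x y => (x != y) && ~~ adj x y).

(** Induced paths. That consecutive nodes differ follows once [adj] is irreflexive, see
    [ipath_uniq]. *)
Fixpoint ipath (s : seq N) : bool :=
  if s is x :: s1 then
    (if s1 is y :: s2 then adj x y && anti1 x s2 else true) && ipath s1
  else true.

(* The chordless cycle [z :: s], with [z] singled out. *)
Definition ring (z : N) (s : seq N) : bool :=
  [&& ipath s, z \notin s & [seq w <- s | adj z w] == [:: head z s; last z s]].

Lemma anti1_cons x y s : anti1 x (y :: s) = [&& x != y, ~~ adj x y & anti1 x s].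
Proof. by rewrite /anti1 /= andbA. Qed.

Lemma anti1_cat x s t : anti1 x (s ++ t) = anti1 x s && anti1 x t.
Proof. exact: all_cat. Qed.

Lemma anti1_rcons x s y :
  anti1 x (rcons s y) = [&& x != y, ~~ adj x y & anti1 x s].
Proof. by rewrite -cats1 anti1_cat /anti1 /= andbT andbC andbA. Qed.

Lemma anti_cons x s t : anti (x :: s) t = anti1 x t && anti s t.
Proof. exact: allrel_consl. Qed.

Lemma anti_catl s1 s2 t : anti (s1 ++ s2) t = anti s1 t && anti s2 t.
Proof. exact: allrel_catl. Qed.

Lemma anti_catr s t1 t2 : anti s (t1 ++ t2) = anti s t1 && anti s t2.
Proof. exact: allrel_catr. Qed.

Lemma anti_revl s t : anti (rev s) t = anti s t.
Proof. exact: allrel_revl. Qed.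

Lemma anti_revr s t : anti s (rev t) = anti s t.
Proof. exact: allrel_revr. Qed.

Lemma anti1P x s :
  reflect (forall y, y \in s -> x != y /\ ~~ adj x y) (anti1 x s).
Proof. by apply: (iffP allP) => H y /H /andP. Qed.

Lemma antiP s t :
  reflect (forall x y, x \in s -> y \in t -> x != y /\ ~~ adj x y) (anti s t).
Proof.
apply: (iffP allrelP) => H x y xs yt; first by case/andP: (H x y xs yt).
by apply/andP; apply: H.
Qed.

Lemma anti_sub s1 s2 t1 t2 :
  {subset s1 <= s2} -> {subset t1 <= t2} -> anti s2 t2 -> anti s1 t1.
Proof. by move=> s12 t12 /antiP H; apply/antiP => x y /s12 xs /t12; exact: H. Qed.

Lemma anti1_sub x t1 t2 : {subset t1 <= t2} -> anti1 x t2 -> anti1 x t1.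
Proof. by move=> t12 /anti1P H; apply/anti1P => y /t12; exact: H. Qed.

Lemma anti1E x s : anti1 x s = anti [:: x] s.
Proof. by rewrite anti_cons andbT. Qed.

Lemma anti1_notin x s : anti1 x s -> x \notin s.
Proof. by move/anti1P=> H; apply/negP => /H []; rewrite eqxx. Qed.

Lemma anti1_filter x s : anti1 x s -> [seq w <- s | adj x w] = [::].
Proof.
move/anti1P=> H; apply/eqP; rewrite -(negbK (_ == _)) -has_filter.
by apply/hasPn => y /H [].
Qed.

Lemma ipath_cons x y s :
  ipath [:: x, y & s] = [&& adj x y, anti1 x s & ipath (y :: s)].
Proof. by rewrite [RHS]andbA. Qed.

Lemma ipath_path x s : ipath (x :: s) -> path adj x s.
Proof. by elim: s x => // y s IH x; rewrite ipath_cons => /and3P[/= -> _ /IH]. Qed.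

Lemma ipath_split s x t :
  ipath (s ++ x :: t) = [&& ipath (rcons s x), ipath (x :: t) & anti s t].
Proof.
elim: s => [|a s IH]; first by rewrite andbT.
case: s IH => [_|b s IH].
  by rewrite [LHS]/= anti_cons !andbT /= andbAC andbC -!andbA; do !bool_congr.
rewrite [_ ++ _]/= ipath_cons IH [rcons _ _]/= ipath_cons anti_cons anti1_cat.
rewrite anti1_cons anti1_rcons.
by case: (adj a b); case: (anti1 a s) => //=;
   case: (a != x) => //=; case: (adj a x) => //=; rewrite ?andbT ?andbF //=;
   do !bool_congr; case: (anti1 a t); rewrite ?andbF ?andbT.
Qed.

Lemma ipath_catl s t : ipath (s ++ t) -> ipath s.
Proof.
case/lastP: s => // s x; rewrite cat_rcons ipath_split.
by case/and3P.
Qed.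

Lemma ipath_catr s t : ipath (s ++ t) -> ipath t.
Proof. by case: t => // y t; rewrite ipath_split; case/and3P. Qed.

Lemma ipath_cat s x y t :
  ipath (rcons s x ++ y :: t) =
  [&& ipath (rcons s x), adj x y, anti s (y :: t), anti1 x t & ipath (y :: t)].
Proof.
rewrite cat_rcons ipath_split ipath_cons.
by case: (ipath _) => //=; case: (adj x y) => //=; case: (anti1 x t) => //=;
   rewrite andbC.
Qed.

Hypothesis adj_sym : symmetric adj.

Lemma antiC s t : anti s t = anti t s.
Proof.
by apply/antiP/antiP => H x y xs yt; rewrite eq_sym adj_sym; exact: H.
Qed.

Lemma ipath_rev s : ipath (rev s) = ipath s.
Proof.
elim: s => // x [|y s] IH //.
rewrite !rev_cons -cats1 cat_rcons ipath_split -rev_cons IH ipath_cons.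
rewrite anti_revl antiC -anti1E ipath_cons adj_sym /= andbT andbC -!andbA.
by do !bool_congr.
Qed.

Lemma anti_consr s y t : anti s (y :: t) = anti1 y s && anti s t.
Proof. by rewrite antiC anti_cons antiC. Qed.

Hypothesis adj_irr : irreflexive adj.

Lemma ipath_uniq s : ipath s -> uniq s.
Proof.
elim: s => // x [|y s] IH //; rewrite ipath_cons => /and3P[xy xs /IH us].
rewrite cons_uniq us andbT inE negb_or anti1_notin // andbT.
by apply: contraTneq xy => ->; rewrite adj_irr.
Qed.

Lemma ipath_filter_head x s :
  ipath (x :: s) -> s != [::] -> [seq w <- s | adj x w] = [:: head x s].
Proof.
by case: s => // y s; rewrite ipath_cons => /and3P[/= -> /anti1_filter -> _].
Qed.

(** The form in which cycles are built and taken apart below, with the two neighbours of [z]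
    displayed. *)
Lemma ringE z x m y :
  ring z (x :: rcons m y) =
  [&& ipath (x :: rcons m y), adj z x, adj z y & anti1 z m].
Proof.
rewrite /ring; have [|] := boolP (ipath _); last by [].
move=> /ipath_uniq; rewrite /= mem_rcons !inE negb_or rcons_uniq last_rcons.
case/andP=> /andP[xy xm] /andP[ym um].
rewrite mem_rcons !inE !negb_or.
apply/idP/and3P => [/andP[/and3P[zx zy zm] /eqP E]|[zx zy zm]].
  have {}E : [seq w <- x :: rcons m y | adj z w] = [:: x; y] by [].
  have F w : w \in [:: x; y] -> adj z w.
    by rewrite -E mem_filter => /andP[].
  have zax : adj z x by apply: F; rewrite inE eqxx.
  have zay : adj z y by apply: F; rewrite !inE eqxx orbT.
  split=> //.
  move: E; rewrite /= filter_rcons zax zay => -[].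
  rewrite -[[:: y]]/(rcons [::] y) => /rcons_inj[E].
  apply/anti1P => w wm; split; first by apply: contraNneq zm => ->.
  apply/negP => zw; have: w \in [seq w <- m | adj z w] by rewrite mem_filter zw.
  by rewrite E.
rewrite /= filter_rcons zx zy (anti1_filter zm) eqxx andbT (anti1_notin zm).
rewrite andbT; apply/andP; split.
  by apply: contraTneq zx => ->; rewrite adj_irr.
by apply: contraTneq zy => ->; rewrite adj_irr.
Qed.

Lemma ring_shape z s : ring z s -> exists x m y, s = x :: rcons m y.
Proof.
case: s => [|x s]; first by case/and3P.
case/lastP: s => [|m y]; last by exists x, m, y.
by case/and3P => _ _ /=; case: ifP => _ /eqP.
Qed.

Lemma ring_rot1 z x s : ring z (x :: s) -> ring x (rcons s z).
Proof.
move=> /[dup] /ring_shape[x' [m [y [_ ->]]]]; rewrite ringE => /and4P[ip zx zy zm].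
case: m ip zm => [|a m] ip zm.
  rewrite -[rcons _ z]/(y :: rcons [::] z) ringE /= (adj_sym y z) zy (adj_sym x z) zx.
  by case/andP: ip => /andP[->].
rewrite [rcons _ _]/= in ip *; move: ip; rewrite ipath_cons => /and3P[xa xm ip].
rewrite [rcons _ _]/= ringE xa adj_sym zx xm !andbT -!cats1 -catA.
rewrite -[_ :: _]/((a :: m) ++ y :: [:: z]) ipath_split rcons_cons ip.
by rewrite antiC -anti1E zm /= adj_sym zy.
Qed.

Lemma ring_rot z s1 w s2 : ring z (s1 ++ w :: s2) -> ring w (s2 ++ z :: s1).
Proof.
elim: s1 z s2 => [|a s1 IH] z s2; first by rewrite cats1; exact: ring_rot1.
by move/ring_rot1; rewrite -cats1 -catA => /IH; rewrite -catA.
Qed.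

Lemma split_last (a : pred N) t : has a t ->
  exists p w q, [/\ t = p ++ w :: q, a w & ~~ has a q].
Proof.
elim: t => //= x t IH; have [/IH [p [w [q [-> aw aq]]]] _|nt] := boolP (has a t).
  by exists (x :: p), w, q.
by rewrite orbF => ax; exists [::], x, t.
Qed.

Lemma split_first (a : pred N) t : has a t ->
  exists p w q, [/\ t = p ++ w :: q, a w & ~~ has a p].
Proof.
rewrite -has_rev => /split_last[p [w [q [E aw aq]]]].
exists (rev q), w, (rev p); split; rewrite ?has_rev //.
by rewrite -[t]revK E rev_cat rev_cons cat_rcons.
Qed.

(** From an induced path for the tail, [x] jumps to its last neighbour on it, which leaves no chord
    at [x]; if [x] already occurs there, the path is cut at [x]. *)
Lemma ipath_shorten x s : path adj x s ->
  exists s', [/\ ipath (x :: s'), last x s' = last x s & {subset s' <= s}].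
Proof.
elim: s x => [|y s IH] x /=; first by exists [::].
case/andP=> xy /IH [s' [ips lasts sub]].
have subt : {subset y :: s' <= y :: s}.
  by move=> w; rewrite !inE => /predU1P[->|/sub->]; rewrite ?eqxx ?orbT.
have lastt : last x (y :: s') = last y s by [].
move: (y :: s') ips lastt subt (mem_head y s') => t ipt lastt subt yt.
have [xin|xnin] := boolP (x \in t).
  case/splitPr: xin ipt lastt subt => p q ip; rewrite last_cat /= => <- sub'.
  exists q; split=> //; first exact: ipath_catr ip.
  by move=> w wq; apply: sub'; rewrite mem_cat inE wq !orbT.
have /split_last[p [w [q [Et xw xq]]]] : has (adj x) t by apply/hasP; exists y.
exists (w :: q); split.
- rewrite xw (@ipath_catr p) ?andbT -?Et //.
  apply/anti1P => v vq; split; last by apply: (hasPn xq).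
  by apply: contraNneq xnin => ->; rewrite Et mem_cat inE vq !orbT.
- by rewrite -lastt Et last_cat.
- by move=> v vq; apply: subt; rewrite Et mem_cat vq orbT.
Qed.

Lemma ipath_nbr s x : ipath s -> 1 < size s -> x \in s ->
  exists2 y, y \in s & adj x y.
Proof.
move=> ip s2 xs; case/splitPr: xs ip s2 => p q.
case: q => [|y q]; last first.
  move/ipath_catr; rewrite ipath_cons => /and3P[xy _ _] _.
  by exists y => //; rewrite mem_cat !inE eqxx !orbT.
case/lastP: p => // p y; rewrite cat_rcons => /ipath_catr.
rewrite ipath_cons adj_sym => /and3P[xy _ _] _.
by exists y => //; rewrite mem_cat !inE eqxx !orbT.
Qed.

Lemma ipath_intro x s : uniq (x :: s) -> path adj x s ->
  (forall p u q v w, x :: s = p ++ u :: q ++ v :: w -> adj u v -> q = [::]) ->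
  ipath (x :: s).
Proof.
elim: s x => // y s IH x; rewrite cons_uniq [path _ _ _]/=.
move=> /andP[xs us] /andP[xy ps] H; rewrite ipath_cons xy /=; apply/andP; split.
  apply/anti1P => w ws; split.
    by apply: contraNneq xs => ->; rewrite inE ws orbT.
  apply/negP => xw; case/splitPr: ws H => p q /(_ [::] x (y :: p) w q).
  by move=> /(_ _ xw); rewrite -!cat_cons => /(_ erefl).
by apply: IH => // p u q v w E; apply: (H (x :: p)); rewrite E.
Qed.

End InducedPaths.

Section InducedPathsEq.

Variables (N : eqType) (adj adj' : rel N).

Lemma eq_in_ipath s :
  {in s &, adj =2 adj'} -> ipath adj s = ipath adj' s.
Proof.
elim: s => // x [|y s] IH // H; rewrite !ipath_cons.
rewrite H ?inE ?eqxx ?orbT // IH; last first.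
  by move=> u v us vs; rewrite H // inE (us, vs) orbT.
suff -> : anti1 adj x s = anti1 adj' x s by [].
by apply: eq_in_all => v vs; rewrite H // !inE ?eqxx ?vs ?orbT.
Qed.

Lemma eq_in_anti s t :
  {in s & t, adj =2 adj'} -> anti adj s t = anti adj' s t.
Proof.
by move=> H; apply: eq_in_all => x xs; apply: eq_in_all => y yt; rewrite H.
Qed.

Lemma eq_in_ring z s : ring adj z s ->
  {in z :: s &, adj =2 adj'} -> ring adj' z s.
Proof.
move=> /and3P[ip zs /eqP F] H; apply/and3P; split=> //.
  by rewrite -eq_in_ipath // => u v us vs; rewrite H // inE (us, vs) orbT.
by rewrite -F; apply/eqP/eq_in_filter => v vs; rewrite H // !inE ?eqxx ?vs ?orbT.
Qed.

End InducedPathsEq.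

Arguments antiP {N adj s t}.
Arguments anti1P {N adj x s}.
Arguments ipath {N} adj s : simpl never.

(* The cycle [z :: s] alternates between vertices and hyperedges and has length
   2 modulo 4, i.e. an odd number of vertices. *)
Definition odd_hole (N : eqType) (adj : rel N) : Prop :=
  exists z s, ring adj z s /\ size s %% 4 = 1.

(** * Cycles and connecting paths in bipartite graphs *)

Section Bipartite.

Variables (N : finType) (side : pred N) (adj : rel N).
Hypothesis adj_sym : symmetric adj.
Hypothesis bip : forall x y, adj x y -> side x = ~~ side y.

Lemma bip_irr : irreflexive adj.
Proof. by move=> x; apply/negP => /bip; case: (side x). Qed.

Lemma side_path x s : path adj x s -> side (last x s) = side x (+) odd (size s).
Proof.
elim: s x => [|y s IH] x /=; first by rewrite addbF.
by case/andP=> /bip -> /IH ->; case: (side y); case: (odd _).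
Qed.

Lemma ring_odd z s : ring adj z s -> odd (size s).
Proof.
move=> /[dup] /(ring_shape)[x [m [y ->]]].
rewrite (ringE bip_irr) => /and4P[/ipath_path /side_path].
rewrite last_rcons size_rcons /= size_rcons => E /bip zx /bip; rewrite zx E /=.
by case: (side x); case: (odd _).
Qed.

(** The cycle consists of [z] and [s] and has even length, so without odd holes its length is 0
    modulo 4. *)
Lemma ring_size z s : ~ odd_hole adj -> ring adj z s -> size s %% 4 = 3.
Proof.
move=> noOH /[dup] /ring_odd o r.
have : size s %% 4 != 1 by apply/eqP => E; apply: noOH; exists z, s.
lia.
Qed.

Lemma path_inner_nbrs x m y e :
  path adj x (rcons m y) -> uniq (x :: rcons m y) -> e \in m ->
  exists u v, [/\ adj e u, adj e v, u != v, u \in x :: m & v \in rcons m y].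
Proof.
move=> + + em; case/splitPr: em => p q.
rewrite rcons_cat rcons_cons cat_path -cat_cons cat_uniq => /and3P[_ pe qp].
case E: (rcons q y) qp => [|v q'] /=; first by case: (q) E.
case/andP=> ev _ /and3P[_ /norP[_ /norP[vp _]] _].
exists (last x p), v; split=> //; first by rewrite adj_sym.
- by apply: contraNneq vp => <-; exact: mem_last.
- have: last x p \in x :: p by exact: mem_last.
  by rewrite !inE mem_cat => /orP[->|->] //; rewrite orbT.
- by rewrite mem_cat !inE eqxx !orbT.
Qed.

(** The walk is cut to a piece between [l] and [r] that stops at its first node with a neighbour in
    [r], then begun at its last node with a neighbour in [l], and finally shortened to an induced
    path. *)
Lemma ear (e : rel N) (P : pred N) (l r : seq N) x q :
  (forall u v, e u v -> adj u v && P v) -> anti adj l r ->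
  path e x q -> x \in l -> last x q \in r ->
  exists p0 p, [/\ ipath adj (p0 :: p), has (adj p0) l & has (adj (last p0 p)) r] /\
    [/\ anti adj l p, anti adj (belast p0 p) r, all P (p0 :: p)
      & all (fun z => (z \notin l) && (z \notin r)) (p0 :: p)].
Proof.
move=> eP lr.
pose out z := (z \notin l) && (z \notin r).
pose cl z := has (adj z) l; pose cr z := has (adj z) r.
have lrN z : z \in l -> z \notin r.
  by move=> zl; apply/negP => /(antiP lr z z zl)[]; rewrite eqxx.
have lrA u v : u \in l -> v \in r -> ~~ adj u v.
  by move=> ul /(antiP lr u v ul)[].
pose good := exists x0 w, [/\ path adj x0 w, all P (x0 :: w), all out (x0 :: w), cl x0
                              & cr (last x0 w) && ~~ has cr (belast x0 w)].
have step : forall q x, path e x q -> last x q \in r ->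
  [\/ x \in r, good | out x /\ exists w, [/\ path adj x w, all P w, all out w
                              & cr (last x w) && ~~ has cr (belast x w)]].
  elim=> [|y q' IH] x0 /=; first by move=> _ xr; constructor 1.
  case/andP=> /eP /andP[xy Py] /IH H /H {H} [yr|g|[oy [w [pw Pw ow /andP[cw nw]]]]].
  - have [|xr] := boolP (x0 \in r); first by constructor 1.
    constructor 3; split; last first.
      exists [::]; split=> //=; rewrite andbT; apply/hasP; by exists y.
    rewrite /out xr andbT; apply/negP => xl.
    by move: (lrA _ _ xl yr); rewrite xy.
  - by constructor 2.
  have [|xr] := boolP (x0 \in r); first by constructor 1.
  have [xl|xl] := boolP (x0 \in l).
    constructor 2; exists y, w; split=> //=; rewrite ?Py ?oy //; last exact/andP.
    by apply/hasP; exists x0 => //; rewrite adj_sym.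
  constructor 3; split; first by rewrite /out xl.
  have [cx|ncx] := boolP (cr x0).
    by exists [::]; split=> //=; rewrite cx.
  exists (y :: w); split=> //=; rewrite ?xy ?Py ?oy //.
  by rewrite cw (negPf ncx).
move=> pq xl lastr; case: (step _ _ pq lastr) => [xr|g|[]]; last by rewrite /out xl.
  by move: (lrN _ xl); rewrite xr.
case: g => x0 [w [pw Pw ow cx /andP[cw nw]]].
have /split_last[s [u [t [E cu nt]]]] : has cl (x0 :: w) by rewrite /= cx.
have pt : path adj u t.
  case: s E => [[<- <-] //|x1 s [_ Ew]].
  by move: pw; rewrite Ew cat_path => /andP[_] /= /andP[].
have lt : last u t = last x0 w by rewrite -[RHS]/(last x0 (x0 :: w)) E last_cat.
have subt : {subset u :: t <= x0 :: w} by move=> z; rewrite E mem_cat orbC => ->.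
have [t' [ipt lt' subt']] := ipath_shorten pt.
have subt2 : {subset u :: t' <= x0 :: w}.
  move=> z; rewrite inE => zt; apply: subt; rewrite inE.
  by case/orP: zt => [->//|/subt' ->]; rewrite orbT.
exists u, t'; split; split=> //.
- by rewrite lt' lt.
- apply/antiP => z z' zl /[dup] zt' /subt' zt; split.
    apply: contraTneq zl => ->.
    by have /subt2/(allP ow)/andP[] : z' \in u :: t' by rewrite inE zt' orbT.
  have := hasPn nt _ zt; apply: contra => zz'.
  by apply/hasP; exists z => //; rewrite adj_sym.
- apply/antiP => z z' zt z'r.
  have zt2 : z \in u :: t' by exact: mem_belast zt.
  split.
    apply: contraTneq z'r => <-.
    by have /andP[] := allP ow _ (subt2 _ zt2).
  have : z \in belast x0 w.
    have := subt2 _ zt2; rewrite lastI mem_rcons inE => /predU1P[Ez|//].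
    have := ipath_uniq bip_irr ipt; rewrite lastI rcons_uniq lt' lt -Ez.
    by rewrite zt.
  by move/(hasPn nw); apply: contra => zz'; apply/hasP; exists z'.
- by apply/allP => z /subt2; exact: (allP Pw).
- by apply/allP => z /subt2; exact: (allP ow).
Qed.

End Bipartite.

(** * Ears at a hub *)

Section Hub.

Variables (N : finType) (side : pred N) (adj : rel N).
Hypothesis adj_sym : symmetric adj.
Hypothesis bip : forall x y, adj x y -> side x = ~~ side y.

Let irr : irreflexive adj := bip_irr bip.

Variable h : N.

Definition off (z : N) : bool := (z != h) && ~~ adj h z.

Definition off_adj : rel N := [rel x y | [&& off x, off y & adj x y]].

(* This is how the disjointness of the large hyperedges is used: a hyperedge
   meeting the hub [h] has at most two elements. *)
Hypothesis deg2 : forall e t u v, adj h t -> adj t e -> e != h ->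
  adj e u -> adj e v -> u != t -> v != t -> u = v.

Lemma nbr3 e t u v w : adj h t -> adj e t -> e != h ->
  adj e u -> adj e v -> adj e w -> u != v -> u != w -> v != w -> False.
Proof.
move=> ht et eh eu ev ew uv uw vw; rewrite adj_sym in et.
have D := deg2 ht et eh.
have [ut|ut] := eqVneq u t; last have [vt|vt] := eqVneq v t.
- by subst u; move: vw; rewrite (D v w) ?eqxx // eq_sym.
- by subst v; move: uw; rewrite (D u w) ?eqxx // eq_sym.
- by move: uv; rewrite (D u v) ?eqxx.
Qed.

(** The first and the last neighbour of [q] on [r]. The last one, [z'], is not adjacent to [a]:
    otherwise [a], [q] and the node after [z'] would be three neighbours of [z'], against [deg2]. *)
Lemma legs a r c q : ipath adj (a :: rcons r c) -> adj h a -> h \notin r ->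
  has (adj q) r -> q \notin a :: rcons r c ->
  exists r1 z r2 r3 z' r4,
    [/\ r = r1 ++ z :: r2, adj q z & anti1 adj q r1] /\
    [/\ r = r3 ++ z' :: r4, adj q z', anti1 adj q r4 & anti1 adj a (z' :: rcons r4 c)].
Proof.
move=> ip ha hr /[dup] /split_first[r1 [z [r2 [E1 qz n1]]]].
move=> /split_last[r3 [z' [r4 [E2 qz' n4]]]] qnot.
exists r1, z, r2, r3, z', r4.
have qr : q \notin r.
  by move: qnot; rewrite inE mem_rcons inE !negb_or => /and3P[].
have A s : {subset s <= r} -> ~~ has (adj q) s -> anti1 adj q s.
  move=> sub ns; apply/anti1P => w ws; split; last exact: hasPn ns _ ws.
  by apply: contraNneq qr => ->; exact: sub.
split; split=> //.
- by apply: A => // w ws; rewrite E1 mem_cat ws.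
- by apply: A => // w ws; rewrite E2 mem_cat inE ws !orbT.
case: r3 E2 => [|x r3] E2.
  have z'r : z' \in r by rewrite E2 mem_head.
  have [u [v [zu zv uv ux vx]]] :=
    path_inner_nbrs adj_sym (ipath_path ip) (ipath_uniq irr ip) z'r.
  have sub w : w \in a :: r \/ w \in rcons r c -> w != q.
    move=> H; apply: contraNneq qnot => <-.
    by case: H; rewrite !inE mem_rcons !inE => /orP[->|->]; rewrite ?orbT.
  have az' : adj a z' by move: ip; rewrite E2 rcons_cons ipath_cons => /and3P[].
  case: (@nbr3 z' a u v q); rewrite ?(adj_sym z') //; try by apply: sub; tauto.
  - by apply: contraNneq hr => <-.
  - by rewrite adj_sym.
  - by rewrite adj_sym.
move: ip; rewrite E2 rcons_cons ipath_cons => /and3P[_ H _].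
by apply: (anti1_sub _ H) => w ws; rewrite rcons_cat mem_cat ws orbT.
Qed.

Lemma join u y p0 p z v :
  ipath adj (rcons u y) -> ipath adj (p0 :: p) -> ipath adj (z :: v) ->
  adj p0 y -> anti adj u (p0 :: p) -> anti1 adj y p ->
  adj (last p0 p) z -> anti adj (p0 :: p) v -> anti1 adj z (belast p0 p) ->
  anti adj (rcons u y) (z :: v) ->
  ipath adj (rcons u y ++ (p0 :: p) ++ z :: v).
Proof.
move=> ipu ipp ipv yp0 up yp pz pv zp uv.
rewrite ipath_cat ipu adj_sym yp0 -cat_cons anti_catr up anti1_cat yp.
move: uv; rewrite -cats1 anti_catl -anti1E => /andP[-> ->] /=.
rewrite -[p0 :: p ++ _]/((p0 :: p) ++ _) lastI ipath_cat -lastI ipp pz ipv.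
rewrite (anti_consr adj_sym) zp andbT /=.
move: pv; rewrite lastI -cats1 anti_catl -anti1E => /andP[-> ->].
by [].
Qed.

Hypothesis noOH : ~ odd_hole adj.

(* A shortest connection between [l] and [r] closes up four chordless cycles, one
   through [a] and three through [h], whose lengths cannot all be 0 modulo 4. *)
Lemma ear_config a b c l r x y :
  ipath adj (a :: rcons l b) -> ipath adj (a :: rcons r c) ->
  anti adj (rcons l b) (rcons r c) ->
  adj h a -> adj h b -> adj h c -> all off l -> all off r ->
  x \in l -> y \in r -> connect off_adj x y -> False.
Proof.
move=> ipl ipr lr ha hb hc offl offr xl yr /connectP[q pq Ey].
have oe u v : off_adj u v -> adj u v && off v by case/and3P=> _ -> ->.
have lr' : anti adj l r.
  by apply: (anti_sub _ _ lr) => w ws; rewrite mem_rcons inE ws orbT.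
have lq : last x q \in r by rewrite -Ey.
have [p0 [p [[ipp cl cr] [lp pr offp outp]]]] :=
  ear adj_sym bip oe lr' pq xl lq.
have hoff s : all off s -> anti1 adj h s.
  by move=> os; apply/anti1P => w /(allP os)/andP[wh hw]; rewrite eq_sym.
have hnot s : all off s -> h \notin s by move=> /hoff /anti1_notin.
(* No node [w] of the ear is adjacent to a neighbour [t] of [h]: it already has two neighbours on
   the ear extended into [l] and [r], both different from [t], against [deg2]. *)
have tP t : adj h t -> anti1 adj t (p0 :: p).
  move=> ht; apply/anti1P => w wp; split.
    by apply: contraTneq ht => ->; have /andP[] := allP offp _ wp.
  apply/negP => tw.
  case/hasP: cl => x0 x0l px0; case/hasP: cr => y0 y0r py0.
  have pth : path adj x0 (rcons (p0 :: p) y0).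
    rewrite rcons_cons /= adj_sym px0 rcons_path py0 andbT.
    exact: ipath_path ipp.
  have unq : uniq (x0 :: rcons (p0 :: p) y0).
    rewrite cons_uniq rcons_uniq mem_rcons inE negb_or (ipath_uniq irr ipp) andbT.
    rewrite -andbA; apply/and3P; split.
    - by have [] := antiP lr' _ _ x0l y0r.
    - by apply/negP => /(allP outp); rewrite x0l.
    - by apply/negP => /(allP outp); rewrite y0r andbF.
  have [u [v [wu wv uv ux vx]]] := path_inner_nbrs adj_sym pth unq wp.
  have offT z : off z -> z != t.
    by move=> oz; apply: contraTneq ht => <-; case/andP: oz.
  move: uv; rewrite (deg2 ht tw _ wu wv) ?eqxx //.
  - by have /andP[] := allP offp _ wp.
  - apply: offT; move: ux; rewrite inE => /predU1P[->|]; first exact: (allP offl).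
    exact: (allP offp).
  - apply: offT; move: vx; rewrite mem_rcons inE => /predU1P[->|].
      exact: (allP offr).
    exact: (allP offp).
have p0out : p0 \notin a :: rcons l b.
  have := allP outp p0 (mem_head _ _).
  rewrite inE mem_rcons inE !negb_or => /andP[-> _]; rewrite andbT.
  have /anti1P/(_ p0 (mem_head _ _))[+ _] := tP a ha.
  by have /anti1P/(_ p0 (mem_head _ _))[+ _] := tP b hb; rewrite !(eq_sym p0) => -> ->.
have pmout : last p0 p \notin a :: rcons r c.
  have := allP outp _ (mem_last _ _).
  rewrite inE mem_rcons inE !negb_or => /andP[_ ->]; rewrite andbT.
  have /anti1P/(_ _ (mem_last _ _))[+ _] := tP a ha.
  have /anti1P/(_ _ (mem_last _ _))[+ _] := tP c hc.
  by rewrite !(eq_sym (last _ _)) => -> ->.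
(* [y1] and [y2] are the first and last neighbours of [p0] on [l], [z1] and [z2] those of
   [last p0 p] on [r]. Turning off at these nodes keeps the four cycles chordless. *)
have [l1 [y1 [l2 [l3 [y2 [l4 [[El1 py1 n1] [El2 py2 n4 al4]]]]]]]] :=
  legs ipl ha (hnot _ offl) cl p0out.
have [r1 [z1 [r2 [r3 [z2 [r4 [[Er1 pz1 m1] [Er2 pz2 m4 ar4]]]]]]]] :=
  legs ipr ha (hnot _ offr) cr pmout.
have sl1 : {subset rcons l1 y1 <= l}.
  by move=> w; rewrite El1 mem_rcons mem_cat !inE => /orP[->|->]; rewrite ?orbT.
have sl4 : {subset y2 :: l4 <= l}.
  by move=> w; rewrite El2 mem_cat !inE => /orP[->|->]; rewrite ?orbT.
have sr1 : {subset rcons r1 z1 <= r}.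
  by move=> w; rewrite Er1 mem_rcons mem_cat !inE => /orP[->|->]; rewrite ?orbT.
have sr4 : {subset z2 :: r4 <= r}.
  by move=> w; rewrite Er2 mem_cat !inE => /orP[->|->]; rewrite ?orbT.
have hmid m : {subset m <= l ++ (p0 :: p) ++ r} -> anti1 adj h m.
  move=> sub; apply: hoff; apply/allP => w /sub; rewrite !mem_cat.
  by case/or3P; [exact: (allP offl) | exact: (allP offp) | exact: (allP offr)].
have lP u : {subset u <= l} -> anti1 adj p0 u -> anti adj u (p0 :: p).
  move=> ul pu; rewrite (anti_consr adj_sym) pu.
  by apply: (anti_sub ul _ lp).
have Pr v : {subset v <= r} -> anti1 adj (last p0 p) v -> anti adj (p0 :: p) v.
  move=> vr pv; rewrite lastI -cats1 anti_catl -anti1E pv andbT.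
  by apply: (anti_sub _ vr pr).
have PT t : adj h t -> anti adj (p0 :: p) [:: t].
  by move=> /tP; rewrite (antiC adj_sym) -anti1E.
have yP y' : y' \in l -> anti1 adj y' p.
  by move=> y'l; rewrite anti1E; apply: (anti_sub _ _ lp) => // w; rewrite inE => /eqP->.
have zP z' : z' \in r -> anti1 adj z' (belast p0 p).
  move=> z'r; rewrite anti1E (antiC adj_sym).
  by apply: (anti_sub _ _ pr) => // w; rewrite inE => /eqP->.
have y1l : y1 \in l by apply: sl1; rewrite mem_rcons mem_head.
have y2l : y2 \in l by apply: sl4; rewrite mem_head.
have z1r : z1 \in r by apply: sr1; rewrite mem_rcons mem_head.
have z2r : z2 \in r by apply: sr4; rewrite mem_head.
have sl1' : {subset l1 <= l} by move=> w wl; apply: sl1; rewrite mem_rcons inE wl orbT.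
have sl4' : {subset l4 <= l} by move=> w wl; apply: sl4; rewrite inE wl orbT.
have sr1' : {subset r1 <= r} by move=> w wl; apply: sr1; rewrite mem_rcons inE wl orbT.
have sr4' : {subset r4 <= r} by move=> w wl; apply: sr4; rewrite inE wl orbT.
have ipl1 : ipath adj (a :: rcons l1 y1).
  by move: ipl; rewrite El1 rcons_cat rcons_cons -cat_cons -cat_rcons => /ipath_catl.
have ipr1 : ipath adj (a :: rcons r1 z1).
  by move: ipr; rewrite Er1 rcons_cat rcons_cons -cat_cons -cat_rcons => /ipath_catl.
have ipl4 : ipath adj (y2 :: rcons l4 b).
  by move: ipl; rewrite El2 rcons_cat rcons_cons -cat_cons => /ipath_catr.
have ipr4 : ipath adj (z2 :: rcons r4 c).
  by move: ipr; rewrite Er2 rcons_cat rcons_cons -cat_cons => /ipath_catr.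
have ips s t : ipath adj s -> t = rev s -> ipath adj t.
  by move=> + ->; rewrite ipath_rev.
have bl : anti adj [:: b] (p0 :: p) by rewrite (antiC adj_sym) PT.
have al : anti adj [:: a] (p0 :: p) by rewrite (antiC adj_sym) PT.
have sl1b : {subset rcons l1 y1 <= rcons l b}.
  by move=> w /sl1; rewrite mem_rcons inE => ->; rewrite orbT.
have sl4b : {subset y2 :: rcons l4 b <= rcons l b}.
  move=> w; rewrite -rcons_cons !mem_rcons !inE => /orP[->//|wl].
  by rewrite sl4 ?orbT // inE.
have sr1c : {subset rcons r1 z1 <= rcons r c}.
  by move=> w /sr1; rewrite mem_rcons inE => ->; rewrite orbT.
have sr4c : {subset z2 :: rcons r4 c <= rcons r c}.
  move=> w; rewrite -rcons_cons !mem_rcons !inE => /orP[->//|wl].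
  by rewrite sr4 ?orbT // inE.
have sl4r : {subset rcons (rev l4) y2 <= l}.
  by move=> w; rewrite -rev_cons mem_rev => /sl4.
have sr1r : {subset z1 :: rev r1 <= r}.
  by move=> w; rewrite -rev_rcons mem_rev => /sr1.
have revl : rcons (b :: rev l4) y2 = rev (y2 :: rcons l4 b).
  by rewrite rev_cons rev_rcons.
have revr : z1 :: rcons (rev r1) a = rev (a :: rcons r1 z1).
  by rewrite rev_cons rev_rcons.
have R3 : ring adj h (a :: rcons (rcons l1 y1 ++ (p0 :: p) ++ z2 :: r4) c).
  rewrite ringE // ha hc hmid ?andbT; last first.
    by move=> w; rewrite !(mem_cat w) => /or3P[/sl1->|->|/sr4->]; rewrite ?orbT.
  rewrite !rcons_cat rcons_cons -cat_cons.
  apply: (@join (a :: l1)); rewrite ?yP ?zP //.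
  - by rewrite anti_cons anti1E al lP.
  - by rewrite -cats1 anti_catr Pr ?PT.
  - by rewrite rcons_cons anti_cons ar4 /=; apply: (anti_sub sl1b sr4c lr).
have R2 : ring adj h (b :: rcons (rcons (rev l4) y2 ++ (p0 :: p) ++ z2 :: r4) c).
  rewrite ringE // hb hc hmid ?andbT; last first.
    by move=> w; rewrite !(mem_cat w) => /or3P[/sl4r->|->|/sr4->]; rewrite ?orbT.
  rewrite !rcons_cat rcons_cons -cat_cons.
  apply: (@join (b :: rev l4)); rewrite ?yP ?zP //.
  - exact: ips ipl4 revl.
  - by rewrite anti_cons anti1E bl anti_revl lP.
  - by rewrite -cats1 anti_catr Pr ?PT.
  - by rewrite revl anti_revl; apply: (anti_sub sl4b sr4c lr).
have R4 : ring adj h (b :: rcons (rcons (rev l4) y2 ++ (p0 :: p) ++ z1 :: rev r1) a).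
  rewrite ringE // hb ha hmid ?andbT; last first.
    by move=> w; rewrite !(mem_cat w) => /or3P[/sl4r->|->|/sr1r->]; rewrite ?orbT.
  rewrite !rcons_cat rcons_cons -cat_cons.
  apply: (@join (b :: rev l4)); rewrite ?yP ?zP //.
  - exact: ips ipl4 revl.
  - exact: ips ipr1 revr.
  - by rewrite anti_cons anti1E bl anti_revl lP.
  - by rewrite -cats1 anti_catr anti_revr Pr ?PT.
  - rewrite revl revr anti_revl anti_revr (anti_consr adj_sym) al4 /=.
    exact: (anti_sub sl4b sr1c lr).
have R1 : ring adj a (rcons l1 y1 ++ (p0 :: p) ++ z1 :: rev r1).
  have revr' : z1 :: rev r1 = rev (rcons r1 z1) by rewrite rev_rcons.
  have ipath_tail s : ipath adj (a :: s) -> ipath adj s.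
    by rewrite -cat1s => /ipath_catr.
  apply/and3P; split.
  - apply: join; rewrite ?yP ?zP ?lP ?anti_revr ?Pr //.
    + exact: ipath_tail ipl1.
    + by apply: ips (ipath_tail _ ipr1) _.
    + rewrite revr' anti_revr; exact: (anti_sub sl1b sr1c lr).
  - rewrite mem_cat negb_or (mem_cat a (p0 :: p)) negb_or (anti1_notin (tP _ ha)).
    rewrite revr' mem_rev.
    have /andP[-> _] := ipath_uniq irr ipl1.
    by have /andP[-> _] := ipath_uniq irr ipr1.
  rewrite filter_cat (filter_cat _ (p0 :: p)) (anti1_filter (tP _ ha)) revr' filter_rev.
  rewrite (ipath_filter_head ipl1) -?size_eq0 ?size_rcons //.
  rewrite (ipath_filter_head ipr1) -?size_eq0 ?size_rcons //=.
  have headE u s t : head a (rcons s u ++ t) = head a (rcons s u) by case: (s).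
  have lastE u s t : last a (t ++ rev (rcons s u)) = head a (rcons s u).
    by rewrite last_cat; case: (s) => // v s'; rewrite rcons_cons rev_cons last_rcons.
  by rewrite headE (catA _ (p0 :: p)) lastE.
(* The sizes for [R3] and [R4] minus that for [R2] give that for [R1] plus 2, so they cannot all be
   3 modulo 4. *)
have := (ring_size bip noOH R1, ring_size bip noOH R2,
         ring_size bip noOH R3, ring_size bip noOH R4).
rewrite !(size_cat, size_rcons, size_rev) /= !(size_cat, size_rcons, size_rev) /=.
rewrite !size_cat /= size_rev; clear => -[[[]]]; lia.
Qed.

End Hub.

(** * Tree houses *)

Section TreeHouse.

Variables (N : eqType) (side : pred N) (adj : rel N).

(* [r :: q] runs from the root [r] to an element of the hub [g]; [size q] is twice
   the (odd) number of edges of this path of the tree house. *)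
Definition leg (g r : N) (q : seq N) : bool :=
  [&& ipath adj (r :: q), g \notin q, [seq w <- q | adj g w] == [:: last g q]
    & size q %% 4 == 2].

Definition house (g r : N) (q1 q2 q3 : seq N) : bool :=
  [&& [&& ~~ side g, adj g r & g != r], leg g r q1, leg g r q2, leg g r q3
    & [&& anti adj q1 q2, anti adj q1 q3 & anti adj q2 q3]].

Definition tree_house : Prop := exists g r q1 q2 q3, house g r q1 q2 q3.

Lemma leg_ring g r q : adj g r -> g != r -> leg g r q -> ring adj g (r :: q).
Proof.
move=> gr gr' /and4P[ip gq /eqP F sq]; apply/and3P; split=> //.
  by rewrite inE negb_or gr'.
by rewrite /= gr F; case: (q) sq.
Qed.

Lemma leg_last g r q : leg g r q -> adj g (last g q) /\ last g q \in q.
Proof.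
move=> /and4P[_ _ /eqP F _].
have : last g q \in [seq w <- q | adj g w] by rewrite F mem_head.
by rewrite mem_filter => /andP.
Qed.

Hypothesis adj_sym : symmetric adj.

(** Used to carry a tree house of a subgraph over to the whole graph, where its nodes must not be
    isolated in the subgraph. *)
Lemma house_nbr g r q1 q2 q3 : house g r q1 q2 q3 ->
  forall z, z \in [:: g, r & q1 ++ q2 ++ q3] -> exists y, adj z y.
Proof.
case/and5P=> /and3P[_ gr _] L1 L2 L3 _ z.
have legN q z' : leg g r q -> z' \in q -> exists v, adj z' v.
  move=> Lq zq; have [_ lq] := leg_last Lq; have [ipq _ _ _] := and4P Lq.
  case: (ipath_nbr adj_sym (x := z') ipq) => [||v _ ?]; last by exists v.
    by case: (q) lq.
  by rewrite inE zq orbT.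
rewrite 2!inE !mem_cat => /or3P[/eqP->|/eqP->|]; first by exists r.
  by exists g; rewrite adj_sym.
by case/or3P; exact: legN.
Qed.

End TreeHouse.

Lemma eq_in_house (N : eqType) (side : pred N) (adj adj' : rel N) g r q1 q2 q3 :
  {in g :: r :: q1 ++ q2 ++ q3 &, adj =2 adj'} ->
  house side adj g r q1 q2 q3 = house side adj' g r q1 q2 q3.
Proof.
move=> H.
have A s t : {subset s <= q1 ++ q2 ++ q3} -> {subset t <= q1 ++ q2 ++ q3} ->
    anti adj s t = anti adj' s t.
  move=> ss tt; apply: eq_in_anti => x y /ss xs /tt yt.
  by apply: H; rewrite !(in_cons g) !(in_cons r) (xs, yt) !orbT.
have L q : {subset q <= q1 ++ q2 ++ q3} -> leg adj g r q = leg adj' g r q.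
  move=> qq; rewrite /leg.
  have sub : {subset r :: q <= g :: r :: q1 ++ q2 ++ q3}.
    move=> x; rewrite inE => /predU1P[->|/qq xq]; first by rewrite !inE eqxx orbT.
    by rewrite !(in_cons g) !(in_cons r) xq !orbT.
  rewrite (@eq_in_ipath _ adj adj') => [|x y /sub xs /sub ys]; last exact: H.
  rewrite (@eq_in_filter _ (adj g) (adj' g)) // => x xq.
  by apply: H; rewrite ?mem_head // sub // inE xq orbT.
have s1 : {subset q1 <= q1 ++ q2 ++ q3} by move=> x; rewrite mem_cat => ->.
have s2 : {subset q2 <= q1 ++ q2 ++ q3}.
  by move=> x; rewrite !mem_cat => ->; rewrite orbT.
have s3 : {subset q3 <= q1 ++ q2 ++ q3}.
  by move=> x; rewrite !mem_cat => ->; rewrite !orbT.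
by rewrite /house !A // !L // H // !inE eqxx ?orbT.
Qed.

(** * The part of a component *)

Section Components.

Variables (N : finType) (side : pred N) (adj : rel N).
Hypothesis adj_sym : symmetric adj.
Hypothesis bip : forall x y, adj x y -> side x = ~~ side y.

Let irr : irreflexive adj := bip_irr bip.

Variable h : N.
Hypothesis deg2 : forall e t u v, adj h t -> adj t e -> e != h ->
  adj e u -> adj e v -> u != t -> v != t -> u = v.
Hypothesis noOH : ~ odd_hole adj.

Notation off := (off adj h).
Notation off_adj := (off_adj adj h).

Lemma off_adj_sym : symmetric off_adj.
Proof. by move=> x y; rewrite /off_adj /= adj_sym andbCA. Qed.

Lemma off_conn_sym : connect_sym off_adj.
Proof. exact/sym_connect_sym/off_adj_sym. Qed.

(** Components are indexed by all nodes [rho]; [comp rho] is empty unless [rho] is the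
    representative of a component. *)
Definition comp (rho z : N) : bool := off z && (fingraph.root off_adj z == rho).

Lemma comp_off rho z : comp rho z -> off z.
Proof. by case/andP. Qed.

Lemma comp_connect rho x y : comp rho x -> comp rho y -> connect off_adj x y.
Proof.
case/andP=> _ /eqP xr /andP[_ /eqP yr].
by rewrite -(root_connect off_conn_sym) xr yr.
Qed.

Lemma comp_adj rho x y : comp rho x -> off y -> adj x y -> comp rho y.
Proof.
case/andP=> ox /eqP <- oy xy; rewrite /comp oy /=.
rewrite (root_connect off_conn_sym) off_conn_sym; apply: connect1.
by rewrite /off_adj /= ox oy.
Qed.

Lemma hub_nadj t t' : adj h t -> adj h t' -> ~~ adj t t'.
Proof.
move=> /bip ht /bip ht'; apply/negP => /bip.
by move: ht ht'; case: (side h); case: (side t); case: (side t').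
Qed.

(** Let [b], [a], [c] be the first three neighbours of [h] on the path. The two arcs between them
    are not empty and lie in the component, so they are connected off [h], which [ear_config]
    excludes. *)
Lemma ipath_three rho s : ipath adj s ->
  all (fun z => comp rho z || adj h z) s -> 2 < count (adj h) s -> False.
Proof.
move=> ip Ds cs.
have nadjD l : {subset l <= s} -> ~~ has (adj h) l -> all (comp rho) l.
  move=> sub nl; apply/allP => z zl.
  by have := allP Ds _ (sub _ zl); rewrite (negPf (hasPn nl _ zl)) orbF.
have /split_first[s0 [b [t [E hb n0]]]] : has (adj h) s by rewrite has_count; lia.
have ct : 1 < count (adj h) t.
  move: cs; rewrite E count_cat /= hb.
  by move: n0; rewrite has_count -leqNgt leqn0 => /eqP ->.
have /split_first[l [a [t' [E' ha nl]]]] : has (adj h) t by rewrite has_count; lia.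
have ct' : 0 < count (adj h) t'.
  move: ct; rewrite E' count_cat /= ha.
  by move: nl; rewrite has_count -leqNgt leqn0 => /eqP ->.
have /split_first[r [c [s4 [E'' hc nr]]]] : has (adj h) t' by rewrite has_count.
have ip' : ipath adj ((b :: l) ++ a :: rcons r c).
  apply: (@ipath_catl _ _ _ s4); apply: (@ipath_catr _ _ s0).
  suff -> : ((b :: l) ++ a :: rcons r c) ++ s4 = b :: t by rewrite -E.
  by rewrite E' E'' -catA !cat_cons cat_rcons.
have Dl : all (comp rho) l.
  apply: nadjD => // z zl.
  by rewrite E mem_cat in_cons E' mem_cat zl !orbT.
have Dr : all (comp rho) r.
  apply: nadjD => // z zr.
  by rewrite E mem_cat in_cons E' mem_cat in_cons E'' mem_cat zr !orbT.
move: ip'; rewrite ipath_split => /and3P[ipl ipr lr].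
case: l ipl Dl lr {nl E'} => [|x l] ipl Dl lr.
  by move: ipl; rewrite ipath_cons (negPf (hub_nadj hb ha)).
case: r ipr Dr lr {nr E''} => [|y r] ipr Dr lr.
  by move: ipr; rewrite ipath_cons (negPf (hub_nadj ha hc)).
have offs u : all (comp rho) u -> all off u.
  by apply: sub_all => z /comp_off.
apply: (@ear_config _ _ _ adj_sym bip h deg2 noOH a b c (rev (x :: l)) (y :: r) x y) => //.
- by rewrite -rev_cons -rev_rcons (ipath_rev adj_sym).
- by rewrite -rev_cons anti_revl.
- by rewrite all_rev offs.
- exact: offs.
- by rewrite mem_rev mem_head.
- exact: mem_head.
- apply: (@comp_connect rho); first by case/andP: Dl.
  by case/andP: Dr.
Qed.

Lemma comp_path rho t s y y' : t != s -> adj h t -> adj h s ->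
  adj t y -> adj s y' -> comp rho y -> comp rho y' ->
  exists p, ipath adj (t :: rcons p s) /\ all (comp rho) p.
Proof.
move=> ts ht hs ty sy Dy Dy'.
have /connectP[q pq Ey'] := comp_connect Dy Dy'.
have pathD z w : comp rho z -> path off_adj z w -> path adj z w && all (comp rho) w.
  elim: w z => //= v w IH z Dz /andP[/and3P[oz ov zv] pw].
  have Dv := comp_adj Dz ov zv.
  by have /andP[-> ->] := IH _ Dv pw; rewrite zv Dv.
have /andP[pq' Dq] := pathD _ _ Dy pq.
have : path adj t (rcons (y :: q) s) by rewrite rcons_path /= ty pq' -Ey' adj_sym.
case/ipath_shorten=> s' [ips]; rewrite last_rcons => Es sub.
case/lastP: s' ips Es sub => [|p s'] ips; first by move=> /= E; rewrite E eqxx in ts.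
rewrite last_rcons => Es sub; subst s'.
exists p; split=> //; apply/allP => z zp.
have := sub z; rewrite !mem_rcons !inE zp orbT => /(_ isT) /orP[/eqP Ez|zq].
  have := ipath_uniq irr ips.
  by rewrite -rcons_cons rcons_uniq inE -Ez zp orbT.
move: zq => /predU1P[->//|]; exact: (allP Dq).
Qed.

(** Closed by [h], the path becomes a chordless cycle of length [size m + 3]. *)
Lemma hub_ring x m y : ipath adj (x :: rcons m y) -> adj h x -> adj h y ->
  all (fun z => (z != h) && ~~ adj h z) m -> size m %% 4 = 1.
Proof.
move=> ip hx hy om.
have : ring adj h (x :: rcons m y).
  rewrite ringE // ip hx hy /=; apply/anti1P => z /(allP om).
  by rewrite eq_sym => /andP.
by move/(ring_size bip noOH); rewrite /= size_rcons; lia.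
Qed.

Section Lift.

Variables (rho : N) (O : pred N).

Notation D := (comp rho).

(* [O] will be the set of neighbours of [h] with an odd number of neighbours in
   [D], so that all degrees of [part] are even. *)
Definition part : rel N := fun x y =>
  adj x y && [|| D x, D y, (x == h) && O y | (y == h) && O x].

Lemma part_adj x y : part x y -> adj x y.
Proof. by case/andP. Qed.

Lemma part_sym : symmetric part.
Proof.
move=> x y; rewrite /part adj_sym; case: (adj y x) => //=.
by case: (D x); case: (D y) => //=; rewrite orbC.
Qed.

Lemma part_bip x y : part x y -> side x = ~~ side y.
Proof. by move/part_adj/bip. Qed.

Lemma part_touch x y : part x y -> x != h -> D x || adj h x.
Proof.
case/andP=> xy + xh; case/or4P => [->//|Dy|/andP[/eqP E]|/andP[/eqP E _]].
- have [hx|hx] := boolP (adj h x); first by rewrite orbT.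
  rewrite orbF; apply: comp_adj Dy _ _; last by rewrite adj_sym.
  by rewrite /off xh.
- by rewrite E eqxx in xh.
- by rewrite -E adj_sym xy orbT.
Qed.

Lemma part_agree x y : x != h -> y != h -> D x || adj h x -> D y || adj h y ->
  adj x y = part x y.
Proof.
rewrite /part => /negPf xh /negPf yh; rewrite xh yh /= orbF.
case: (D x); case: (D y) => //=; rewrite ?andbT // => hx hy.
by rewrite (negPf (hub_nadj hx hy)).
Qed.

(** Away from [h] the part is induced on its non-isolated nodes: these lie in the component or are
    neighbours of [h], and two neighbours of [h] are never adjacent. *)
Lemma part_agree_on (S : seq N) : (forall x, x \in S -> exists y, part x y) ->
  {in S &, forall x y, x != h -> y != h -> adj x y = part x y}.
Proof.
move=> HS x y xS yS xh yh; apply: part_agree => //.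
  by have [z /part_touch->] := HS x xS.
by have [z /part_touch->] := HS y yS.
Qed.

Lemma ipath_part s : 1 < size s -> h \notin s -> ipath part s ->
  ipath adj s /\ all (fun z => D z || adj h z) s.
Proof.
move=> s2 hs ip.
have E z : z \in s -> exists y, part z y.
  by case/(ipath_nbr part_sym ip s2) => y _; exists y.
have zh z : z \in s -> z != h by apply: contraTneq => ->.
split.
  rewrite (@eq_in_ipath _ adj part) // => x y xs ys.
  exact: (part_agree_on E xs ys (zh x xs) (zh y ys)).
apply/allP => z zs; have [y] := E z zs.
by move/part_touch => -> //; apply: zh.
Qed.

(** An odd hole avoiding [h] is one of [adj]. One through [h] leaves an induced path on which [h]
    has only two neighbours, even in [adj], by [ipath_three]; so it is an odd hole of [adj], too. *)
Lemma part_oddhole : ~ odd_hole part.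
Proof.
case=> z [s [r sz]].
have [hin|hnin] := boolP (h \in z :: s); last first.
  apply: noOH; exists z, s; split=> //; apply: (eq_in_ring r) => x y xs ys.
  have E w : w \in z :: s -> exists y, part w y.
    have rz := r; move: (rz) => /ring_shape [x0 [m [y0 Es]]].
    rewrite Es ringE in r; last exact: bip_irr part_bip.
    case/and4P: r => ip zx0 _ _.
    rewrite inE => /predU1P[->|]; first by exists x0.
    by rewrite Es => /(ipath_nbr part_sym ip)[|u _ uv]; [rewrite /= size_rcons | exists u].
  symmetry; apply: (part_agree_on E xs ys).
    by apply: contraNneq hnin => <-.
  by apply: contraNneq hnin => <-.
have [s' [r' sz']] : exists s', ring part h s' /\ size s' %% 4 = 1.
  move: hin; rewrite inE => /predU1P[->|hs]; first by exists s.
  case/splitPr: hs r sz => p q /(ring_rot part_sym (bip_irr part_bip)) r' sz'.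
  exists (q ++ z :: p); split=> //; move: sz'.
  by rewrite !size_cat /= !addnS addnC.
have [x [m [y Es]]] := ring_shape r'.
move: r'; rewrite Es (ringE (bip_irr part_bip)) => /and4P[ip hx hy hm].
have hs : h \notin x :: rcons m y.
  rewrite inE mem_rcons inE !negb_or (anti1_notin hm) andbT.
  by apply/andP; split; [move: hx | move: hy]; apply: contraTneq => <-;
     rewrite (bip_irr part_bip).
have [|ipa Da] := ipath_part _ hs ip; first by rewrite /= size_rcons.
have [c3|c2] := ltnP 2 (count (adj h) (x :: rcons m y)).
  exact: ipath_three ipa Da c3.
have := hub_ring ipa (part_adj hx) (part_adj hy).
move: sz'; rewrite Es /= size_rcons => sz'.
suff om : all (fun z => (z != h) && ~~ adj h z) m.
  by move/(_ om); move: sz'; clear; lia.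
have nm : ~~ has (adj h) m.
  rewrite has_count -leqNgt; move: c2.
  rewrite /= -cats1 count_cat /= (part_adj hx) (part_adj hy) addn0 addn1 add1n.
  by rewrite !ltnS.
apply/allP => w wm; rewrite (hasPn nm) // andbT.
by apply: contraTneq wm => ->; exact: anti1_notin hm.
Qed.

Hypothesis side_h : ~~ side h.
Hypothesis noTH : ~ tree_house side adj.

(** A tree house avoiding [h] is one of [adj]. The hub of the tree house cannot be [h], and if [h]
    lies on a leg, the part has all edges of [adj] between [h] and the tree house, so this is again
    one of [adj]. *)
Lemma part_house : ~ tree_house side part.
Proof.
case=> g [r [q1 [q2 [q3 H]]]].
have irr' := bip_irr part_bip.
have houseC g' r' p1 p2 p3 : house side part g' r' p1 p2 p3 ->
    house side part g' r' p2 p1 p3 /\ house side part g' r' p2 p3 p1.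
  rewrite /house => /and5P[-> -> -> -> /and3P[a12 a13 a23]].
  by rewrite (antiC part_sym p2) a12 a13 a23 (antiC part_sym p3) a13.
(* Two legs and the root would form an induced path with three neighbours of [h]: the root and the
   two ends. *)
have central r' p1 p2 p3 : ~ house side part h r' p1 p2 p3.
  move=> /and5P[/and3P[_ hr hr'] L1 L2 _ /andP[a12 _]].
  have [ip1 h1 _ _] := and4P L1; have [ip2 h2 _ _] := and4P L2.
  have [hl1 l1] := leg_last L1; have [hl2 l2] := leg_last L2.
  have ip : ipath part (rev p1 ++ r' :: p2).
    by rewrite ipath_split -rev_cons (ipath_rev part_sym) ip1 ip2 anti_revl.
  have [||ipa Da] := ipath_part _ _ ip.
  - by case: (p1) l1 => // u w _; rewrite size_cat size_rev addnS.
  - by rewrite mem_cat mem_rev inE !negb_or h1 hr' h2.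
  apply: ipath_three ipa Da _.
  rewrite count_cat /= (part_adj hr).
  have c1 : 0 < count (adj h) (rev p1).
    by rewrite -has_count has_rev; apply/hasP; exists (last h p1) => //; exact: part_adj.
  have c2 : 0 < count (adj h) p2.
    by rewrite -has_count; apply/hasP; exists (last h p2) => //; exact: part_adj.
  by rewrite add1n addnS ltnS (leq_add c1 c2).
(* Otherwise [g'], sharing [t] with [h], would have the root and the ends of two legs as three
   neighbours, against [deg2]. *)
have noT g' r' p1 p2 p3 t : house side part g' r' p1 p2 p3 -> g' != h ->
    adj g' t -> ~~ adj h t.
  move=> /and5P[/and3P[_ gr gr'] L1 L2 _ /andP[/antiP a12 _]] gh gt.
  have [gl1 l1] := leg_last L1; have [gl2 l2] := leg_last L2.
  have [/ipath_uniq u1 _ _ _] := and4P L1; have [/ipath_uniq u2 _ _ _] := and4P L2.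
  apply/negP => ht; apply: (@nbr3 _ _ adj_sym _ deg2 g' t r' (last g' p1) (last g' p2)) => //;
    try exact: part_adj.
  - by have := u1 irr'; apply: contraTneq => ->; rewrite cons_uniq l1.
  - by have := u2 irr'; apply: contraTneq => ->; rewrite cons_uniq l2.
  - by have [] := a12 _ _ l1 l2.
have side_hub t : adj h t -> side t.
  by move/bip; case: (side t) side_h => //= + E; rewrite E.
have hleg g' r' p1 p2 p3 : house side part g' r' p1 p2 p3 -> g' != h -> h \in p1 -> False.
  move=> H' gh hp1; have nT := noT _ _ _ _ _ _ H' gh.
  have /and5P[/and3P[sg gr gr'] L1 L2 L3 /and3P[a12 a13 a23]] := H'.
  have R1 := leg_ring gr gr' L1.
  have [gl1 l1] := leg_last L1; have [gl2 l2] := leg_last L2.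
  have [ip1 h1 _ _] := and4P L1; have [ip2 h2 _ _] := and4P L2.
  have rT : ~~ adj h r' by apply: nT; exact: part_adj.
  case/splitPr: hp1 H' L1 a12 a13 R1 gl1 l1 ip1 h1 => pa pb.
  (* Around [h] the leg reads [al], [u], [h], [w], [de]. Here [u] exists because the root is not
     adjacent to [h], and [w] because the leg ends in a vertex. *)
  case/lastP: pa => [|al u] H' L1 a12 a13 R1 gl1 l1 ip1 h1.
    move: ip1; rewrite /= ipath_cons part_sym => /and3P[/part_adj hr _ _].
    by rewrite hr in rT.
  case: pb H' L1 a12 a13 R1 gl1 l1 ip1 h1 => [|w de] H' L1 a12 a13 R1 gl1 l1 ip1 h1.
    move: gl1; rewrite cats1 last_rcons => /part_adj /bip E.
    by rewrite E side_h in sg.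
  have ip1' : ipath part (rcons (r' :: rcons al u) h ++ (w :: de)) by rewrite cat_rcons.
  have hu : adj h u.
    move: ip1; rewrite cat_rcons -cat_cons => /ipath_catr.
    by rewrite ipath_cons part_sym => /and3P[/part_adj].
  have hw : adj h w.
    move: ip1; rewrite -cat_cons => /ipath_catr.
    by rewrite ipath_cons => /and3P[/part_adj].
  have Rh : ring part h (((w :: de) ++ [:: g'; r']) ++ rcons al u).
    by rewrite -catA; apply: (@ring_rot _ _ part_sym irr' g' (r' :: rcons al u)).
  have [ipi hpi _] := and3P Rh.
  have [|ipa Da] := ipath_part _ hpi ipi; first by rewrite /= !size_cat addn2.
  have [c3|c2] := ltnP 2 (count (adj h) (((w :: de) ++ [:: g'; r']) ++ rcons al u)).
    exact: ipath_three ipa Da c3.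
  have [nde nal] : ~~ has (adj h) de /\ ~~ has (adj h) al.
    rewrite !has_count; move: c2; rewrite -cats1 !count_cat /= hw hu.
    by move: (count _ de) (count _ al) => a b; clear; lia.
  have hg : ~~ adj h g' by apply: contra sg; exact: side_hub.
  have hde : h \notin de by apply: contra hpi => E; rewrite mem_cat mem_cat inE E orbT.
  have hal : h \notin al.
    by apply: contra hpi => E; rewrite mem_cat mem_rcons inE E !orbT.
  have hr : r' != h by apply: contraNneq hpi => ->; rewrite !mem_cat !inE eqxx !orbT.
  have free s : h \notin s -> ~~ has (adj h) s -> all (fun z => (z != h) && ~~ adj h z) s.
    move=> hs ns; apply/allP => z zs; rewrite (hasPn ns) // andbT.
    by apply: contraTneq zs => ->.
  have Hc : (size al + size de) %% 4 = 3.
    have := @hub_ring w (de ++ g' :: r' :: al) u.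
    have <- : ((w :: de) ++ [:: g'; r']) ++ rcons al u = w :: rcons (de ++ g' :: r' :: al) u.
      by rewrite -catA rcons_cat.
    rewrite size_cat /= => /(_ ipa hw hu).
    rewrite all_cat /= !free // gh hg hr rT /= => /(_ isT).
    by clear; lia.
  have oal : odd (size al).
    have := side_path part_bip (ipath_path (ipath_catl (s := r' :: rcons al u) ip1)).
    rewrite last_rcons size_rcons /= side_hub //.
    have -> : side r' by have := part_bip gr; case: (side r') sg => //= /negPf ->.
    by case: odd.
  (* A neighbour of [h] on another leg would give two more chordless cycles
     through [h]; with the one above, their lengths are incompatible. *)
  have inner q q' : house side part g' r' (rcons al u ++ [:: h, w & de]) q q' ->
      ~~ has (adj h) q.
    move=> Hq; apply/negP => /split_first[be [t [ga [Eq ht nbe]]]].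
    have /and5P[_ _ Lq _ /andP[aq _]] := Hq.
    have [gl lq] := leg_last Lq; have [ipq gq /eqP Fq _] := and4P Lq.
    have hq : h \notin q.
      apply/negP => hq.
      have [] := antiP aq h h _ hq; last by rewrite eqxx.
      by rewrite mem_cat inE eqxx orbT.
    have ipt : ipath part (r' :: rcons be t).
      by move: ipq; rewrite Eq -cat_rcons -cat_cons => /ipath_catl.
    have sub : {subset rcons be t <= q}.
      by move=> z; rewrite Eq -cat_rcons mem_cat => ->.
    have hbt : h \notin rcons be t by apply: contra hq; exact: sub.
    have hbe : h \notin be by apply: contra hbt; rewrite mem_rcons inE orbC => ->.
    have gbt : anti1 part g' (rcons be t).
      apply/anti1P => z zbt; split; first by apply: contraNneq gq => ->; exact: sub.
      apply/negP => gz.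
      have : z \in [seq w <- q | part g' w] by rewrite mem_filter gz sub.
      rewrite Fq inE => /eqP Ez.
      have nt := nT t _.
      have : ga != [::].
        apply: contraL ht => /eqP Ega; apply: nT; apply: part_adj.
        by move: gl; rewrite Eq Ega cats1 last_rcons.
      case/lastP: ga Eq Ez => // ga v Eq Ez _.
      have := ipath_uniq irr' ipq; rewrite cons_uniq Eq -cat_rcons cat_uniq.
      case/and3P=> _ _ /andP[/hasPn/(_ v) + _].
      rewrite mem_rcons mem_head => /(_ isT).
      by rewrite Ez Eq last_cat /= last_rcons in zbt; rewrite zbt.
    have Ha : (size be + size al) %% 4 = 0.
      have ip : ipath part (rev (rcons be t) ++ r' :: rcons al u).
        rewrite ipath_split -rev_cons (ipath_rev part_sym) ipt anti_revl.
        rewrite (ipath_catl (s := r' :: rcons al u) ip1).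
        apply: (anti_sub sub _ (_ : anti part q (rcons al u ++ [:: h, w & de]))).
          by move=> z; rewrite mem_cat => ->.
        by rewrite (antiC part_sym).
      have [||ipb _] := ipath_part _ _ ip.
      - by rewrite size_cat size_rev size_rcons addSn /= addnS.
      - rewrite mem_cat mem_rev inE !negb_or hbt eq_sym hr mem_rcons inE negb_or hal.
        by rewrite andbT; apply: contraTneq hu => <-; rewrite irr.
      have := @hub_ring t (rev be ++ r' :: al) u.
      move: ipb; rewrite rev_rcons rcons_cat => ipb /(_ ipb ht hu).
      rewrite all_cat all_rev /= !free // hr rT => /(_ isT).
      by rewrite size_cat size_rev /=; clear; lia.
    have Hb : (size be + size de) %% 4 = 3.
      have ip : ipath part (rev (rcons be t) ++ r' :: g' :: rev (w :: de)).
        rewrite ipath_split -rev_cons (ipath_rev part_sym) ipt anti_revl /=.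
        have -> : [:: r', g' & rev (w :: de)] = rev ((w :: de) ++ [:: g'; r']).
          by rewrite rev_cat.
        rewrite (ipath_rev part_sym) (ipath_catl ipi) /=.
        rewrite (anti_consr part_sym) gbt anti_revr.
        apply: (anti_sub sub _ (_ : anti part q (rcons al u ++ [:: h, w & de]))).
          by move=> z zz; rewrite mem_cat in_cons zz !orbT.
        by rewrite (antiC part_sym).
      have [||ipb _] := ipath_part _ _ ip.
      - by rewrite size_cat size_rev size_rcons addSn /= addnS.
      - rewrite mem_cat mem_rev !inE !negb_or hbt !(eq_sym h) hr gh mem_rev inE negb_or hde.
        by rewrite andbT /=; apply: contraTneq hw => <-; rewrite irr.
      have := @hub_ring t (rev be ++ r' :: g' :: rev de) w.
      move: ipb; rewrite rev_rcons rev_cons !rcons_cat => ipb /(_ ipb ht hw).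
      rewrite all_cat all_rev /= all_rev !free // hr rT hg gh => /(_ isT).
      by rewrite size_cat size_rev /= size_rev; clear; lia.
    (* By [Hb] and [Hc], [size be] and [size al] agree modulo 4; then [Ha] makes [size al] even. *)
    by move: Ha Hb Hc oal; clear; lia.
  apply: noTH; exists g', r', (rcons al u ++ [:: h, w & de]), p2, p3.
  have n2 := inner _ _ H'.
  have n3 : ~~ has (adj h) p3.
    apply: (inner _ p2); move: H'; rewrite /house => /and5P[-> -> -> -> /and3P[-> -> ?]].
    by rewrite (antiC part_sym).
  rewrite (@eq_in_house _ _ adj part) //.
  pose S := [:: g', r' & (rcons al u ++ [:: h, w & de]) ++ p2 ++ p3].
  (* On the tree house, [h] has no neighbours in [adj] but [u] and [w]. *)
  have SH z : z \in S -> adj h z -> part h z.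
    have pu : part h u.
      by rewrite part_sym; move: (ipath_path ip1); rewrite cat_path last_rcons => /and3P[].
    have pw : part h w.
      by move: (ipath_path ip1); rewrite cat_path => /and4P[].
    rewrite /S !inE !mem_cat mem_rcons !inE -!orbA => zS hz; move: zS.
    case/or4P=> [/eqP E|/eqP E|/eqP ->//|].
    - by rewrite -E hz in hg.
    - by rewrite -E hz in rT.
    case/or4P=> [zal|/eqP E|/eqP ->//|].
    - by move: (hasPn nal _ zal); rewrite hz.
    - by move: hz; rewrite E irr.
    by case/or3P=> zz; [move: (hasPn nde _ zz) | move: (hasPn n2 _ zz)
      | move: (hasPn n3 _ zz)]; rewrite hz.
  move=> x y xS yS.
  have [xh|xh] := eqVneq x h.
    by subst x; apply/idP/idP; [exact: SH | exact: part_adj].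
  have [yh|yh] := eqVneq y h.
    by subst y; rewrite adj_sym part_sym; apply/idP/idP; [exact: SH | exact: part_adj].
  exact: (part_agree_on (house_nbr part_sym H')).
have [gh|gh] := eqVneq g h; first by subst g; exact: central H.
have [H2 _] := houseC _ _ _ _ _ H; have [H3 _] := houseC _ _ _ _ _ (houseC _ _ _ _ _ H).2.
have [h1|h1] := boolP (h \in q1); first exact: hleg H gh h1.
have [h2|h2] := boolP (h \in q2); first exact: hleg H2 gh h2.
have [h3|h3] := boolP (h \in q3); first exact: hleg H3 gh h3.
apply: noTH; exists g, r, q1, q2, q3.
have /and5P[/and3P[sg gr gr'] L1 L2 L3 _] := H.
have rh : r != h.
  apply: contraNneq side_h => <-; have := part_bip gr.
  by case: (side r) sg => //= /negPf ->.
rewrite (@eq_in_house _ _ adj part) // => x y xS yS.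
have xh z : z \in [:: g, r & q1 ++ q2 ++ q3] -> z != h.
  rewrite !inE !mem_cat => zS; apply: contraTneq zS => ->.
  by rewrite !negb_or eq_sym gh eq_sym rh h1 h2.
exact: (part_agree_on (house_nbr part_sym H) xS yS (xh x xS) (xh y yS)).
Qed.

End Lift.

End Components.

(** * Cycle decompositions and shortest odd cycles *)

(** Unlike an odd hole, this cycle may have chords. The bound on the size excludes running along an
    edge and back. *)
Definition odd_cycle_seq (N : eqType) (adj : rel N) (c : seq N) : bool :=
  [&& uniq c, cycle adj c, 2 < size c & size c %% 4 == 2].

Lemma cat_split (T : Type) (s1 : seq T) x s2 t1 t2 :
  s1 ++ x :: s2 = t1 ++ t2 ->
  (exists u, t1 = s1 ++ x :: u /\ s2 = u ++ t2) \/
  (exists u, s1 = t1 ++ u /\ t2 = u ++ x :: s2).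
Proof.
elim: s1 t1 => [|a s1 IH] [|b t1] /=.
- by move=> <-; right; exists [::].
- by case=> -> ->; left; exists t1.
- by move=> <-; right; exists (a :: s1).
- case=> -> /IH[[u [-> ->]]|[u [-> ->]]]; first by left; exists u.
  by right; exists u.
Qed.

Lemma size_consE (T : Type) (x : T) s : size (x :: s) = (size s).+1.
Proof. by []. Qed.

Lemma count_consE (T : Type) (f : pred T) x s : count f (x :: s) = f x + count f s.
Proof. by []. Qed.

Definition sizeE {T : Type} := (@size_cat T, @size_rcons T, @size_rev T, @size_consE T).

Definition countE {T : Type} := (@count_cat T, @count_rev T, @count_consE T).

(** Reduces the absence of repetitions in a rearranged piece of a cycle to linear arithmetic on
    counts. *)
Lemma uniq_count_le (T : eqType) (s1 s2 : seq T) : uniq s2 ->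
  (forall f : pred T, count f s1 <= count f s2) -> uniq s1.
Proof.
move=> u2 le; apply: count_mem_uniq => x.
have le1 : count_mem x s1 <= 1.
  by apply: leq_trans (le _) _; rewrite count_uniq_mem ?leq_b1.
by rewrite -has_pred1 has_count; case: (count_mem x s1) le1 => [|[|k]].
Qed.

(** * Decomposition of even graphs into cycles *)

Section Cycles.

Variables (N : finType) (side : pred N).

Lemma cycle_even (adj : rel N) c :
  (forall x y, adj x y -> side x = ~~ side y) -> cycle adj c -> ~~ odd (size c).
Proof.
move=> bip; case: c => // x s /= /(side_path bip).
by rewrite last_rcons size_rcons /=; case: (side x); case: odd.
Qed.

(** As degrees are even, [x] has a neighbour other than [y]. It lies on the path and closes a cycle,
    or it extends the path backwards; [n] bounds the number of extensions. *)
Lemma long_path_cycle (adj : rel N) n x y s : irreflexive adj ->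
  symmetric adj -> (forall z, ~~ odd #|adj z|) ->
  uniq [:: x, y & s] -> path adj x (y :: s) -> #|N| <= n + size s ->
  exists c, [&& uniq c, cycle adj c & 2 < size c].
Proof.
move=> irr sym even; elim: n x y s => [|n IH] x y s us ps sn.
  have := uniq_leq_size us (fun z _ => mem_enum N z).
  by rewrite -cardE => /leq_trans /(_ sn); rewrite /= ltnNge leqnSn.
have xy : adj x y by case/andP: ps.
have d2 : 1 < #|adj x|.
  have : 0 < #|adj x| by apply/card_gt0P; exists y.
  by have := even x; case: #|adj x| => [|[|k]].
have [z zy xz] : exists2 z, z != y & adj x z.
  have /card_gt1P[z [z' [xz xz' zz']]] := d2.
  have [E|zy] := eqVneq z y; last by exists z.
  by exists z' => //; rewrite -E eq_sym.
have [zin|zout] := boolP (z \in s); last first.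
  apply: (IH z x (y :: s)).
  - rewrite cons_uniq us andbT !inE !negb_or zy zout !andbT.
    by apply: contraTneq xz => ->; rewrite irr.
  - by rewrite /= sym xz.
  - by rewrite /= addnS.
case/splitPr: zin us ps {sn} => s1 s2 us ps.
exists [:: x, y & rcons s1 z]; apply/and3P; split.
- move: us; rewrite -cat_rcons -!cat_cons cat_uniq; by case/and3P.
- move: ps; rewrite -cat_rcons /= cat_path => /and3P[xy' p1 _].
  by rewrite /= xy' rcons_path p1 last_rcons sym xz.
- by rewrite /= size_rcons.
Qed.

Definition peel (adj : rel N) (c : seq N) : rel N :=
  fun x y => adj x y && ~~ ((x \in c) && ((y == next c x) || (y == prev c x))).

Lemma next_neq_prev (c : seq N) x :
  uniq c -> 2 < size c -> x \in c -> next c x != prev c x.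
Proof.
move=> uc sc xc; case: (rot_to xc) => i s E.
have ur : uniq (x :: s) by rewrite -E rot_uniq.
have sr : 2 < size (x :: s) by rewrite -E size_rot.
apply/eqP => np; have := next_prev uc x; rewrite -np.
rewrite -!(next_rot i uc) E.
case: s ur sr {E} => [|y [|z s]] // /andP[].
rewrite in_cons negb_or in_cons negb_or => /and3P[xy xz _] _ _.
by rewrite /= eqxx (eq_sym y) (negPf xy) eqxx => E; rewrite E eqxx in xz.
Qed.

Lemma peel_sym adj c : symmetric adj -> uniq c -> symmetric (peel adj c).
Proof.
move=> sym uc x y; rewrite /peel sym; case: (adj y x) => //=; congr negb.
apply/idP/idP.
  case/andP=> xc /orP[/eqP->|/eqP->].
    by rewrite mem_next xc prev_next // eqxx orbT.
  by rewrite mem_prev xc next_prev // eqxx.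
case/andP=> yc /orP[/eqP->|/eqP->].
  by rewrite mem_next yc prev_next // eqxx orbT.
by rewrite mem_prev yc next_prev // eqxx.
Qed.

Lemma peel_deg adj c x : symmetric adj -> uniq c -> 2 < size c -> cycle adj c ->
  #|adj x| = #|peel adj c x| + 2 * (x \in c).
Proof.
move=> sym uc sc cc; have [xc|xc] := boolP (x \in c); last first.
  rewrite addn0; apply: eq_card => y.
  by rewrite -[LHS]/(adj x y) -[RHS]/(peel adj c x y) /peel (negPf xc) andbT.
have np := next_neq_prev uc sc xc.
rewrite -(cardID (pred2 (next c x) (prev c x)) (adj x)) addnC.
have -> : #|predI (adj x) (pred2 (next c x) (prev c x))| = 2.
  rewrite -[RHS]/(true.+1) -np -card2; apply: eq_card => y.
  apply/andP/idP => [[]//|yn]; split=> //.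
  suff : adj x y by [].
  by case/orP: yn => /eqP->; rewrite ?next_cycle // sym prev_cycle.
congr (_ + _); apply: eq_card => y.
by rewrite -[RHS]/(peel adj c x y) /peel xc /= andbC.
Qed.

(** Peeling off a cycle keeps the degrees even and takes twice its length from the degree sum, a
    multiple of 8 if the length is 0 modulo 4. *)
Lemma peel_cycles (adj : rel N) : symmetric adj ->
  (forall x y, adj x y -> side x = ~~ side y) -> (forall z, ~~ odd #|adj z|) ->
  8 %| \sum_x #|adj x| \/ exists c, odd_cycle_seq adj c.
Proof.
have [n] := ubnP (\sum_x #|adj x|); elim: n adj => // n IH adj le sym bip even.
have irr := bip_irr bip.
have [x0 dx0|d0] := pickP [pred x | 0 < #|adj x|]; last first.
  by left; rewrite big1 // => x _; have := d0 x; rewrite /= lt0n => /negbFE/eqP.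
have [y xyA] := card_gt0P dx0; have xy : adj x0 y by [].
have [c /and3P[uc cc sc]] : exists c, [&& uniq c, cycle adj c & 2 < size c].
  apply: (@long_path_cycle adj #|N| x0 y [::] irr sym even); last by rewrite addn0.
    by rewrite /= inE andbT; apply: contraTneq xy => ->; rewrite irr.
  by rewrite /= xy.
have E : \sum_x #|adj x| = \sum_x #|peel adj c x| + 2 * size c.
  rewrite (eq_bigr _ (fun x _ => peel_deg x sym uc sc cc)) big_split /=; congr (_ + _).
  by rewrite -big_distrr -big_mkcond /= sum1_card (card_uniqP uc).
have [sc2|sc2] := boolP (size c %% 4 == 2).
  by right; exists c; rewrite /odd_cycle_seq uc cc sc.
have sub x z : peel adj c x z -> adj x z by case/andP.
have [| | | |d8|[c' /and4P[uc' cc' sc' sc2']]] := IH (peel adj c).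
- rewrite -ltnS; apply: leq_trans le; rewrite E ltnS -addn1 leq_add2l muln_gt0 /=.
  exact: ltn_trans sc.
- exact: peel_sym.
- by move=> x z /sub /bip.
- by move=> z; have := even z; rewrite (peel_deg z sym uc sc cc) oddD mul2n odd_double addbF.
- left; rewrite E dvdn_addr // -[8]/(2 * 4) dvdn_pmul2l // /dvdn.
  move: (cycle_even bip cc) sc2; rewrite -dvdn2 => /dvdnP[k ->].
  by clear; lia.
right; exists c'; rewrite /odd_cycle_seq uc' sc' sc2' !andbT /=.
exact: sub_cycle cc'.
Qed.

End Cycles.

Lemma path_rev (T : eqType) (e : rel T) x p y : symmetric e ->
  path e x (rcons p y) -> path e y (rcons (rev p) x).
Proof.
move=> e_sym pp; rewrite -rev_cons -(belast_rcons x p y) -{1}(last_rcons x p y).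
by rewrite rev_path -(eq_path (e := e)) // => u v; rewrite e_sym.
Qed.

(** * Chords of a shortest cycle of length 2 modulo 4 *)

Section ShortestOddCycle.

Variables (N : finType) (side : pred N) (adj : rel N).
Hypothesis adj_sym : symmetric adj.
Hypothesis bip : forall x y, adj x y -> side x = ~~ side y.
Hypothesis hub2 : forall h, ~~ side h -> 2 < #|adj h| ->
  forall e t u v, adj h t -> adj t e -> e != h ->
  adj e u -> adj e v -> u != t -> v != t -> u = v.
Hypothesis noOH : ~ odd_hole adj.
(** A shortest odd cycle with a chord at [h] yields such an induced path with three neighbours of
    [h]; excluding it is left to the decomposition at a hub. *)
Hypothesis no_chorded : forall h b m a l c, ~~ side h ->
  h \notin b :: m ++ a :: rcons l c -> ipath adj (b :: m ++ a :: rcons l c) ->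
  adj h b -> adj h a -> adj h c -> False.

Let irr : irreflexive adj := bip_irr bip.

Lemma even_cycle4 c : cycle adj c -> size c %% 4 != 2 -> 4 %| size c.
Proof.
move=> /(cycle_even bip); rewrite -dvdn2 => /dvdnP[k ->].
by rewrite /dvdn; lia.
Qed.

Section Min.

Variable c0 : seq N.
Hypothesis min : forall c, size c < size c0 -> odd_cycle_seq adj c -> False.

Lemma short_cycle4 c : uniq c -> cycle adj c -> 2 < size c -> size c < size c0 ->
  4 %| size c.
Proof.
move=> uc cc sc lt; apply: even_cycle4 => //.
by apply/negP => sc2; apply: (min lt); apply/and4P.
Qed.

(** The chord cuts the cycle into two shorter ones whose lengths add up to that of the cycle plus 2,
    so not all three lengths are divisible by 4. *)
Lemma arc_chord h A p u q0 q v w : uniq (h :: A) -> cycle adj (h :: A) ->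
  4 %| size (h :: A) -> size (h :: A) < size c0 -> adj u v ->
  A = p ++ u :: (q0 :: q) ++ v :: w -> False.
Proof.
move=> un cy s4 lt uv E.
have un1 : uniq (u :: (q0 :: q) ++ [:: v]).
  move: un; rewrite E cons_uniq => /andP[_].
  by rewrite cat_uniq -cat_rcons -cats1 -cat_cons cat_uniq => /and4P[_ _ + _].
have un2 : uniq (h :: p ++ u :: v :: w).
  move: un; rewrite E; apply: subseq_uniq.
  rewrite -[h :: _]cat1s -[X in subseq _ X]cat1s !cat_subseq //.
  rewrite -[[:: u, v & w]]cat1s -[X in subseq _ X]cat1s !cat_subseq //.
  exact: suffix_subseq.
have := cy; rewrite /= E !(rcons_cat, cat_path) /= !(rcons_cat, cat_path) /=.
case/and5P=> pp lu uq pq /andP[qv pw].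
have cy1 : cycle adj (u :: (q0 :: q) ++ [:: v]).
  by rewrite /= cats1 !rcons_path last_rcons uq pq qv adj_sym uv.
have cy2 : cycle adj (h :: p ++ u :: v :: w).
  by rewrite /= rcons_cat cat_path pp /= lu uv.
have lt1 : size (u :: (q0 :: q) ++ [:: v]) < size c0.
  apply: leq_ltn_trans lt; rewrite E !sizeE /=.
  by clear; lia.
have lt2 : size (h :: p ++ u :: v :: w) < size c0.
  apply: leq_ltn_trans lt; rewrite E !sizeE /=.
  by clear; lia.
have d1 : 4 %| size (u :: (q0 :: q) ++ [:: v]).
  by apply: short_cycle4 => //; rewrite /= size_cat addn1.
have d2 : 4 %| size (h :: p ++ [:: u, v & w]).
  by apply: short_cycle4 => //; rewrite /= size_cat !addnS.
move: s4 d1 d2; rewrite E !sizeE /=.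
by clear; lia.
Qed.

(** Without [h] the cycle is a path on which [a] and both ends are neighbours of [h], so
    [no_chorded] applies once the path is induced. The chord [a h] splits the cycle in two;
    [arc_chord] excludes a chord within either of them, and a chord crossing [a h] is treated at the
    end. *)
Lemma min_chord a l h m : c0 = a :: l ++ h :: m -> odd_cycle_seq adj c0 ->
  adj a h -> l != [::] -> m != [::] -> ~~ side h -> False.
Proof.
move=> Ec /and4P[uc cc _ sc4] ah l0 m0 sh.
have := cc; rewrite Ec /= rcons_cat cat_path /= rcons_path => /and4P[pl lh pm ma].
have uc2 : uniq (h :: m ++ a :: l).
  by have := uc; rewrite -(rot_uniq (size (a :: l))) Ec -cat_cons rot_size_cat.
have ul : uniq (h :: a :: l).
  move: uc2; apply: subseq_uniq; rewrite -cat1s -[X in subseq _ X]cat1s.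
  by rewrite cat_subseq // suffix_subseq.
have um : uniq (h :: m ++ [:: a]).
  move: uc2; apply: subseq_uniq; rewrite -cat1s -[X in subseq _ X]cat1s.
  by rewrite cat_subseq // cat_subseq // sub1seq mem_head.
have cl : cycle adj (h :: a :: l) by rewrite /= adj_sym ah rcons_path pl lh.
have cm : cycle adj (h :: m ++ [:: a]).
  by rewrite /= cats1 !rcons_path last_rcons pm ma ah.
have sl : size (h :: a :: l) < size c0.
  by rewrite Ec /= size_cat /=; case: (m) m0 => //= ? ? _; clear; lia.
have sm : size (h :: m ++ [:: a]) < size c0.
  by rewrite Ec /= !size_cat /=; case: (l) l0 => //= ? ? _; clear; lia.
have dl : 4 %| size (h :: a :: l).
  by apply: short_cycle4 => //=; case: (l) l0.
have dm : 4 %| size (h :: m ++ [:: a]).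
  by apply: short_cycle4 => //=; rewrite size_cat addn1; case: (m) m0.
case: m m0 Ec pm ma uc2 um cm sm dm => // b m _ Ec /andP[hb pm] ma uc2 um cm sm dm.
case/lastP: l l0 Ec pl lh ul uc2 cl sl dl => // l c _ Ec pl lh ul uc2 cl sl dl.
rewrite last_rcons in lh.
have ha : adj h a by rewrite adj_sym.
have hc : adj h c by rewrite adj_sym.
have Hh : 2 < #|adj h|.
  apply/card_gt2P; exists b, a, c; split; first by split.
  move: uc2; rewrite cons_uniq cat_uniq => /and3P[_ _ /andP[/norP[an /hasPn cn] /andP[al _]]].
  split.
  - by apply: contraNneq an => <-; exact: mem_head.
  - by apply: contraNneq al => ->; rewrite mem_rcons mem_head.
  - have := cn c; rewrite mem_rcons mem_head => /(_ isT).
    by apply: contraNneq => ->; exact: mem_head.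
have D2 := hub2 sh Hh.
apply: (no_chorded sh _ _ hb ha hc).
  by move: uc2 => /= /andP[+ _]; exact.
rewrite -cat_cons; apply: (ipath_intro (x := b)); first by case/andP: uc2.
  by rewrite cat_path; apply/and3P; split.
move=> p u [//|q0 q] v w; rewrite -[b :: m ++ _]/((b :: m) ++ _) => E uv; exfalso.
have [[t [Em Eq]]|[t [Ep Ea]]] := cat_split (esym E); last first.
  exact: (arc_chord ul cl dl sl uv Ea).
have [[t' [Et Ew]]|[t' [Et Ea]]] := cat_split Eq.
  apply: (arc_chord um cm dm sm uv (_ : _ = p ++ u :: (q0 :: q) ++ v :: (t' ++ [:: a]))).
  by rewrite Em Et -!catA /= -!catA.
case: t' Et Ea => [|a' t'] Et [Ea1 Ea2].
  apply: (arc_chord um cm dm sm uv (_ : _ = p ++ u :: (q0 :: q) ++ v :: [::])).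
  by rewrite Em Et cats0 -Ea1 -catA.
(* The chords [a h] and [u v] cross. By counting lengths one of two further
   cycles is odd; it is shorter than [c0], except in a degenerate case excluded
   by [D2]. *)
clear E Eq Et q0 q a' Ea1.
have Ec0 : c0 = a :: (t' ++ v :: w) ++ h :: p ++ u :: t by rewrite Ec Em Ea2.
move: cc uc sc4; rewrite Ec0 /= !(rcons_cat, cat_path) /= !(rcons_cat, cat_path) /=.
rewrite rcons_path !(last_cat, last_rcons) /=.
case/andP=> /and3P[pt' tv pw] /and5P[wh pp pu ptt ta] uc sc4.
have uall : uniq (a :: (t' ++ v :: w) ++ h :: p ++ u :: t) by [].
have d3 : 4 %| size (v :: w ++ h :: rcons p u).
  apply: short_cycle4.
  - apply: (uniq_count_le uall) => f.
    by rewrite -cats1 !countE /=; clear; lia.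
  - by rewrite /= rcons_cat cat_path pw /= wh !rcons_path last_rcons pp pu uv.
  - by rewrite /= size_cat /= size_rcons !addnS.
  - rewrite Ec0 !sizeE /=.
    by clear; lia.
have /and3P[/norP[_ /norP[vh _]] /norP[uh _] _] : uniq [:: v; u; h].
  by apply: (uniq_count_le uall) => f; rewrite !countE /=; clear; lia.
have uah : uniq (a :: v :: u :: w ++ h :: p).
  apply: (uniq_count_le uall) => f.
  by rewrite !countE /=; clear; lia.
(* By [dl] and [d3], [size t'] and [size p] agree modulo 4. If they are odd, the cycle of both
   chords and the arcs [t'] and [p] has length 2 modulo 4; if they are even, the cycle of both
   chords and the arcs [w] and [t] has. *)
have [ot|et] := boolP (odd (@size N t')).
  have cycB : odd_cycle_seq adj (a :: t' ++ [:: v, u & rev p] ++ [:: h]).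
    apply/and4P; split.
    - apply: (uniq_count_le uall) => f.
      by rewrite !countE /=; clear; lia.
    - have pr : path adj u (rcons (rev p) h).
        by apply: path_rev; rewrite // rcons_path pp pu.
      by rewrite /= rcons_cat cat_path pt' /= tv adj_sym uv cats1 rcons_path pr
        last_rcons ha.
    - by rewrite /= size_cat /= !addnS.
    - move: d3 dl ot; rewrite Ea2 !sizeE /=.
      by clear; lia.
  (* The cycle is shorter than [c0] unless [w] and [t] are empty. Then [u] is adjacent to [a], and
     [D2] identifies its neighbours [v] and [last h p]. *)
  have [wt|wt] := posnP (@size N w + @size N t); last first.
    apply: (min _ cycB); rewrite Ec0 !sizeE /=.
    by move: wt; clear; lia.
  have [/eqP/size0nil w0 /eqP/size0nil t0] : size w == 0 /\ size t == 0.
    by apply/andP; rewrite -addn_eq0; apply/eqP.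
  rewrite w0 /= in wh; rewrite t0 /= in ta.
  move: uah; rewrite w0 /= !inE !negb_or => /and3P[/and4P[av au ah' ap] /and3P[vu' vh' vp] _].
  have : v = last h p.
    apply: (D2 u a v (last h p) ha) => //.
    - by rewrite adj_sym.
    - by rewrite adj_sym.
    - by rewrite eq_sym.
    have : last h p \in h :: p by exact: mem_last.
    by apply: contraTneq => ->; rewrite inE negb_or ah' ap.
  have : last h p \in h :: p by exact: mem_last.
  by move=> + Ev; rewrite -Ev inE (negPf vp) orbF (negPf vh').
have cycA : odd_cycle_seq adj (v :: w ++ h :: a :: rev t ++ [:: u]).
  apply/and4P; split.
  - apply: (uniq_count_le uall) => f.
    by rewrite !countE /=; clear; lia.
  - have pr : path adj a (rcons (rev t) u).
      by apply: path_rev; rewrite // rcons_path ptt ta.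
    by rewrite /= rcons_cat cat_path pw /= wh ha cats1 rcons_path pr
      last_rcons uv.
  - by rewrite /= size_cat /= !addnS.
  - have := sc4; move: d3 dl et; rewrite Ea2 !sizeE /=.
    by clear; lia.
(* In the degenerate case [v] is adjacent to [a], and [D2] identifies [u] with the successor of [v]
   on the cycle. *)
have [tp|tp] := posnP (@size N t' + @size N p); last first.
  apply: (min _ cycA); rewrite Ec0 !sizeE /=.
  by move: tp; clear; lia.
have [/eqP/size0nil t0 /eqP/size0nil p0] : size t' == 0 /\ size p == 0.
  by apply/andP; rewrite -addn_eq0; apply/eqP.
rewrite t0 /= in tv; rewrite p0 /= in pu.
have wuh : path adj v (rcons w h) by rewrite rcons_path pw.
move: uah; rewrite p0 cats1 /= !inE mem_rcons !inE !negb_or.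
case/and4P=> /and4P[av au ah' aw] /andP[_ vw] uw _.
have [z zw vz] : exists2 z, z \in rcons w h & adj v z.
  by case: (w) wuh => [|z w'] /= /andP[vz _]; [exists h | exists z]; rewrite ?mem_head.
have E3 : u = z.
  apply: (D2 v a u z ha) => //.
  - by rewrite adj_sym.
  - by rewrite eq_sym.
  by apply: contraTneq zw => ->; rewrite mem_rcons inE negb_or ah' aw.
by rewrite E3 zw in uw.
Qed.

End Min.

Lemma odd_cycle_seq_rot s t : odd_cycle_seq adj (s ++ t) = odd_cycle_seq adj (t ++ s).
Proof.
rewrite /odd_cycle_seq -(rot_size_cat s t) rot_uniq size_rot; congr [&& _, _ & _].
by rewrite rot_cycle.
Qed.

(** A shortest odd cycle is not an odd hole, so it has a chord. One end of the chord is a hyperedge,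
    and after a rotation [min_chord] applies. *)
Lemma no_odd_cycle c : ~ odd_cycle_seq adj c.
Proof.
have [n] := ubnP (size c); elim: n c => // n IH c lt oc.
have chord u l v m : odd_cycle_seq adj (u :: l ++ v :: m) ->
    size (u :: l ++ v :: m) = size c -> adj u v -> l != [::] -> m != [::] -> False.
  move=> oc' sc uv l0 m0.
  have min c' : size c' < size (u :: l ++ v :: m) -> odd_cycle_seq adj c' -> False.
    by rewrite sc => lt' oc''; apply: (IH c') => //; apply: leq_trans lt' _; rewrite -ltnS.
  have [sv|sv] := boolP (side v); last exact: (min_chord min _ oc' uv).
  have oc2 : odd_cycle_seq adj (v :: m ++ u :: l).
    by rewrite -cat_cons odd_cycle_seq_rot.
  have s2 : size (v :: m ++ u :: l) = size (u :: l ++ v :: m).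
    by rewrite /= !size_cat /= !addnS addnC.
  rewrite -s2 in min; apply: (min_chord min _ oc2) => //; first by rewrite adj_sym.
  by rewrite (bip uv) sv.
have [uc cc c2 c4] := and4P oc.
case: c uc cc c2 c4 {lt} oc chord => // x [//|y s]; case/lastP: s => // m z.
move=> uc cc c2 c4 oc chord; apply: noOH; exists x, (y :: rcons m z).
split; last by move: c4; rewrite /= size_rcons; clear; lia.
have := cc; rewrite /= !rcons_path last_rcons => /and3P[xy /andP[pm mz] zx].
have [xout uy] := andP uc; rewrite ringE // xy (adj_sym x) zx /=; apply/andP; split.
  apply: ipath_intro => //; first by rewrite rcons_path pm.
  move=> p u [//|q0 q] v w E uv; exfalso.
  apply: (chord u (q0 :: q) v (w ++ x :: p)) => //.
  - have -> : u :: (q0 :: q) ++ v :: w ++ x :: p = (u :: (q0 :: q) ++ v :: w) ++ x :: p.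
      by rewrite /= -catA.
    by rewrite odd_cycle_seq_rot cat_cons -E.
  - have -> : size [:: x, y & rcons m z] = size (x :: p ++ u :: (q0 :: q) ++ v :: w).
      by rewrite -E.
    by rewrite !sizeE /=; clear; lia.
  - by case: (w).
apply/anti1P => w wm; split.
  by apply: contraNneq xout => ->; rewrite inE mem_rcons inE wm !orbT.
apply/negP => xw; case/splitPr: wm chord oc => m1 m2 chord oc.
apply: (chord x (y :: m1) w (rcons m2 z)) => //.
- by rewrite -rcons_cons -rcons_cat cat_cons.
- by rewrite -rcons_cons -rcons_cat cat_cons.
- by case: (m2).
Qed.

End ShortestOddCycle.

(** * Divisibility of the degree sum *)

Lemma odd_sum (I : finType) (P : pred I) (F : I -> nat) :
  odd (\sum_(i | P i) F i) = odd #|[pred i | P i && odd (F i)]|.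
Proof.
rewrite -sum1_card big_mkcondr /= !(big_morph odd oddD (erefl : odd 0 = false)).
by apply: eq_bigr => i _; case: (odd (F i)).
Qed.

Lemma card_sum (N : finType) (P : pred N) : #|P| = \sum_x (P x : nat).
Proof. by rewrite -sum1_card big_mkcond; apply: eq_bigr => x _; rewrite unfold_in; case: (P x). Qed.

(** Singletons are served first, and their elements differ because the sets do. Any other set has at
    least three elements and can avoid two given ones. *)
Lemma distinct_reps (T : finType) (A B C : {set T}) :
  odd #|A| -> odd #|B| -> odd #|C| -> A != B -> A != C -> B != C ->
  exists a b c, [/\ a \in A, b \in B & c \in C] /\ [/\ a != b, a != c & b != c].
Proof.
have one (X Y : {set T}) x y : #|X| = 1 -> #|Y| = 1 -> x \in X -> y \in Y -> X != Y -> x != y.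
  move=> /eqP/cards1P[x' ->] /eqP/cards1P[y' ->]; rewrite !inE => /eqP-> /eqP->.
  by apply: contra => /eqP->.
have ne (X : {set T}) : odd #|X| -> exists x, x \in X.
  by move=> oX; apply/set0Pn; rewrite -card_gt0; case: #|X| oX.
have away (X : {set T}) x y : odd #|X| -> #|X| != 1 -> exists z, [/\ z \in X, z != x & z != y].
  move=> oX X1; have [z zX] : exists z, z \in X :\: [set x; y].
    apply/set0Pn; rewrite -card_gt0.
    have := cardsID [set x; y] X; have := subset_leq_card (subsetIr X [set x; y]).
    have := cards2 x y; case: (x != y) => /=; lia.
  by exists z; move: zX; rewrite !inE negb_or => /andP[/andP[-> ->] ->].
move=> oA oB oC AB AC BC.
have [a aA] := ne _ oA; have [b bB] := ne _ oB; have [c cC] := ne _ oC.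
have [A1|A1] := eqVneq #|A| 1; have [B1|B1] := eqVneq #|B| 1.
- have ab := one _ _ _ _ A1 B1 aA bB AB.
  have [C1|C1] := eqVneq #|C| 1.
    by exists a, b, c; do !split=> //; [exact: one A1 C1 aA cC AC | exact: one B1 C1 bB cC BC].
  have [z [zC za zb]] := away _ a b oC C1.
  by exists a, b, z; do !split=> //; rewrite eq_sym.
- have [C1|C1] := eqVneq #|C| 1.
    have ac := one _ _ _ _ A1 C1 aA cC AC; have [z [zB za zc]] := away _ a c oB B1.
    by exists a, z, c; do !split=> //; rewrite eq_sym.
  have [z [zB za _]] := away _ a a oB B1; have [w [wC wa wz]] := away _ a z oC C1.
  by exists a, z, w; do !split=> //; rewrite eq_sym.
- have [C1|C1] := eqVneq #|C| 1.
    have bc := one _ _ _ _ B1 C1 bB cC BC; have [z [zA zb zc]] := away _ b c oA A1.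
    by exists z, b, c.
  have [z [zA zb _]] := away _ b b oA A1; have [w [wC wb wz]] := away _ b z oC C1.
  by exists z, b, w; do !split=> //; rewrite eq_sym.
- have [z [zA zc _]] := away _ c c oA A1; have [w [wB wc wz]] := away _ c z oB B1.
  by exists z, w, c; do !split=> //; rewrite eq_sym.
Qed.

(** * Even incidence graphs with disjoint large hyperedges *)

Section EvenBigraphs.

Variables (N : finType) (side : pred N).

(** The class of graphs for the induction. Large hyperedges are recognised by their degree in [adj],
    so that their disjointness passes to subgraphs. *)
Definition bigraph (adj : rel N) : Prop :=
  [/\ symmetric adj, forall x y, adj x y -> side x = ~~ side y,
      forall x, ~~ odd #|adj x|
    & forall e f t, ~~ side e -> ~~ side f -> e != f -> adj t e -> adj t f ->
        3 < #|adj e| -> 3 < #|adj f| -> False].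

Lemma handshake (r : rel N) : symmetric r -> (forall x y, r x y -> side x = ~~ side y) ->
  ~~ odd (\sum_x \sum_y (r x y : nat)).
Proof.
move=> sym bip.
have -> : \sum_x \sum_y (r x y : nat) =
    \sum_x \sum_y (side x && r x y : nat) + \sum_x \sum_y (~~ side x && r x y : nat).
  rewrite -big_split; apply: eq_bigr => x _; rewrite -big_split; apply: eq_bigr => y _.
  by case: (side x); rewrite /= ?addn0.
rewrite [X in _ + X]exchange_big /= [X in _ + X](_ : _ = \sum_x \sum_y (side x && r x y : nat)).
  by rewrite addnn odd_double.
apply: eq_bigr => x _; apply: eq_bigr => y _; rewrite (sym y x).
by case rxy: (r x y); rewrite ?andbF // (bip _ _ rxy) andbT.
Qed.

(** As degrees are even, a hyperedge with three elements has at least four; so [e], sharing [t] with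
    the large hyperedge [h], has at most two. *)
Lemma bigraph_hub2 adj : bigraph adj -> forall h, ~~ side h -> 2 < #|adj h| ->
  forall e t u v, adj h t -> adj t e -> e != h ->
  adj e u -> adj e v -> u != t -> v != t -> u = v.
Proof.
move=> [sym bip even disj] h sh dh e t u v ht te eh eu ev ut vt.
have se : ~~ side e by have := bip _ _ ht; have := bip _ _ te; move: sh;
  case: (side h); case: (side t); case: (side e).
apply/eqP/negPn/negP => uv.
have big z : 2 < #|adj z| -> 3 < #|adj z|.
  by have := even z; case: #|adj z| => [|[|[|[|k]]]].
apply: (disj e h t) => //; try exact: big; first by rewrite sym.
apply: big; apply/card_gt2P; exists t, u, v; split; first by split=> //; rewrite unfold_in sym.
by split=> //; rewrite eq_sym.
Qed.

Lemma sub_bigraph (adj adj' : rel N) : bigraph adj -> (forall x y, adj' x y -> adj x y) ->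
  symmetric adj' -> (forall x, ~~ odd #|adj' x|) -> bigraph adj'.
Proof.
move=> [sym bip even disj] sub sym' even'; split=> // [x y /sub/bip//|].
move=> e f t se sf ef /sub te /sub tf de df; apply: (disj e f t) => //.
  by apply: leq_trans de (subset_leq_card _); apply/subsetP => x; exact: sub.
by apply: leq_trans df (subset_leq_card _); apply/subsetP => x; exact: sub.
Qed.

Section Induced.

Variables (adj adj' : rel N).
Hypothesis sym' : symmetric adj'.
Hypothesis bip' : forall x y, adj' x y -> side x = ~~ side y.
Hypothesis sub : forall x y, adj' x y -> adj x y.
Hypothesis induced : forall x x' y y', adj' x x' -> adj' y y' -> adj x y -> adj' x y.

Lemma induced_eq (S : seq N) : (forall x, x \in S -> exists y, adj' x y) ->
  {in S &, adj' =2 adj}.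
Proof.
move=> HS x y /HS[x' xx'] /HS[y' yy']; apply/idP/idP; first exact: sub.
exact: induced xx' yy'.
Qed.

Lemma induced_odd_hole : odd_hole adj' -> odd_hole adj.
Proof.
case=> z [s [r sz]]; exists z, s; split=> //; apply: (eq_in_ring r).
apply: induced_eq => w.
have [x0 [m [y0 Es]]] := ring_shape r.
move: r; rewrite Es ringE; last exact: bip_irr bip'.
case/and4P=> ip zx0 _ _; rewrite inE => /predU1P[->|]; first by exists x0.
case/(ipath_nbr sym' ip) => [|u _ uv]; last by exists u.
by rewrite /= size_rcons.
Qed.

Lemma induced_tree_house : tree_house side adj' -> tree_house side adj.
Proof.
case=> g [r [q1 [q2 [q3 H]]]]; exists g, r, q1, q2, q3.
by rewrite -(eq_in_house side (induced_eq (house_nbr sym' H))).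
Qed.

End Induced.

(** * Splitting an even graph at a hub *)

Section HubParts.

Variables (adj : rel N) (h : N).
Hypothesis big : bigraph adj.
Hypothesis side_h : ~~ side h.
Hypothesis deg_h : 2 < #|adj h|.

Let sym : symmetric adj := let: And4 s _ _ _ := big in s.
Let bip : forall x y, adj x y -> side x = ~~ side y := let: And4 _ b _ _ := big in b.
Let even : forall x, ~~ odd #|adj x| := let: And4 _ _ e _ := big in e.
Let irr : irreflexive adj := bip_irr bip.
Let deg2 := bigraph_hub2 big side_h deg_h.

Notation D := (comp adj h).

Definition pdeg (rho x : N) : nat := \sum_y (adj x y && D rho y : nat).

(** The set [O(D)] for the component [D rho]. *)
Definition podd (rho : N) : pred N := fun t => adj h t && odd (pdeg rho t).

Notation P rho := (part adj h rho (podd rho)).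

Lemma comp_nbr rho x y : D rho x -> adj x y -> D rho y || adj h y.
Proof.
move=> Dx xy; have [hy|hy] := boolP (adj h y); first by rewrite orbT.
rewrite orbF; apply: (comp_adj sym Dx _ xy); rewrite /off hy andbT.
by apply: contraTneq xy => ->; rewrite sym; have /andP[/andP[]] := Dx.
Qed.

Lemma comp_nhub rho x : D rho x -> ~~ adj h x.
Proof. by case/andP=> /andP[]. Qed.

Lemma comp_neqh rho x : D rho x -> x != h.
Proof. by case/andP=> /andP[]. Qed.

Lemma pdeg0 rho x : ~~ D rho x -> ~~ adj h x -> pdeg rho x = 0.
Proof.
move=> Dx hx; rewrite /pdeg big1 // => y _.
case xy: (adj x y) => //=; case Dy: (D rho y) => //.
have := comp_nbr Dy (_ : adj y x); rewrite sym xy => /(_ isT).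
by rewrite (negPf Dx) (negPf hx).
Qed.

(** The degrees in the component have an even sum, in which the edges inside it count twice; so the
    number of edges from it to the neighbours of [h] is even. *)
Lemma podd_even rho : ~~ odd #|podd rho|.
Proof.
have : ~~ odd (\sum_(x | D rho x) #|adj x|).
  by rewrite odd_sum (eq_card0 (_ : _ =i pred0)) // => x; rewrite !inE (negPf (even x)) andbF.
have -> : \sum_(x | D rho x) #|adj x| =
    \sum_x \sum_y ([&& adj x y, D rho x & D rho y] : nat) + \sum_(t | adj h t) pdeg rho t.
  have -> : \sum_(t | adj h t) pdeg rho t = \sum_x \sum_y ([&& adj x y, D rho x & adj h y] : nat).
    rewrite [RHS]exchange_big /= [LHS]big_mkcond; apply: eq_bigr => t _.
    case ht: (adj h t); last by rewrite big1 // => y _; rewrite !andbF.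
    by apply: eq_bigr => y _; rewrite andbT sym.
  rewrite -big_split big_mkcond; apply: eq_bigr => x _ /=.
  case Dx: (D rho x); last by rewrite !big1 // => y _; rewrite andbF.
  rewrite card_sum -big_split; apply: eq_bigr => y _ /=.
  case xy: (adj x y) => //=; have H := comp_nbr Dx xy.
  have [Dy|Dy] := boolP (D rho y); first by rewrite (negPf (comp_nhub Dy)).
  by move: H; rewrite (negPf Dy) => /= ->.
rewrite oddD (negPf (handshake _ _)) /= ?odd_sum => [//||x y /andP[/bip //]].
by move=> x y; rewrite sym; congr (_ && _); rewrite andbC.
Qed.

Lemma part_deg rho x : #|P rho x| =
  if D rho x then #|adj x| else if x == h then #|podd rho|
  else if adj h x then pdeg rho x + podd rho x else 0.
Proof.
have [Dx|Dx] := boolP (D rho x).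
  by apply: eq_card => y; rewrite -[LHS]/(P rho x y) /part Dx /= andbT.
have [->|xh] := eqVneq x h.
  apply: eq_card => y; rewrite -[LHS]/(P rho h y) -[RHS]/(podd rho y) /part.
  have -> : D rho h = false by apply/negP => /comp_neqh; rewrite eqxx.
  rewrite eqxx /=; case hy: (adj h y); last by rewrite /podd hy.
  have -> : (y == h) = false by apply: contraTF hy => /eqP ->; rewrite irr.
  by rewrite orbF; case Dy: (D rho y) => //; have := comp_nhub Dy; rewrite hy.
have E y : (P rho x y : nat) = (adj x y && D rho y) + ((y == h) && podd rho x).
  rewrite /part (negPf Dx) (negPf xh) /=; have [->|yh] := eqVneq y h; last first.
    by rewrite orbF addn0.
  have -> : D rho h = false by apply/negP => /comp_neqh; rewrite eqxx.
  rewrite andbF /= sym; rewrite /podd; by case: (adj h x).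
rewrite card_sum (eq_bigr _ (fun y _ => E y)) big_split /= -/(pdeg rho x).
have -> : \sum_y ((y == h) && podd rho x : nat) = podd rho x.
  by rewrite (bigD1 h) //= eqxx big1 ?addn0 // => y /negPf->.
by case: ifP => [//|hx]; rewrite pdeg0 ?hx // /podd hx.
Qed.

Lemma part_bigraph rho : bigraph (P rho).
Proof.
apply: (sub_bigraph big) => [x y /part_adj//||x]; first exact: part_sym.
rewrite part_deg; case: ifP => // _; case: ifP => _; first exact: podd_even.
by case: ifP => // hx; rewrite oddD /podd hx /=; case: odd.
Qed.

Lemma pdeg_sum t : adj h t -> \sum_rho pdeg rho t + 1 = #|adj t|.
Proof.
move=> ht.
have E y : y != h -> \sum_rho (adj t y && D rho y : nat) = adj t y.
  move=> yh; case ty: (adj t y) => /=; last by rewrite big1.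
  have oy : off adj h y.
    by rewrite /off yh; apply: contraL ty => hy; apply: (hub_nadj bip ht hy).
  rewrite (bigD1 (fingraph.root (off_adj adj h) y)) //= /comp oy eqxx big1 // => rho.
  by rewrite eq_sym => /negPf->.
rewrite exchange_big card_sum /= (bigD1 h) //= [RHS](bigD1 h) //= [adj t h]sym ht.
rewrite big1 => [|rho _]; last first.
  by case Dh: (D rho h); rewrite ?andbF //; have := comp_neqh Dh; rewrite eqxx.
by rewrite add0n addnC; congr (_ + _); apply: eq_bigr => y /E.
Qed.

(** The degree of [t] is even and its edge to [h] leads to no component, so the degrees of [t] into
    the components have an odd sum. *)
Lemma podd_count_odd t : adj h t -> odd #|[pred rho | podd rho t]|.
Proof.
move=> ht; have := odd_sum xpredT (fun rho => pdeg rho t).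
have -> : #|[pred rho | true && odd (pdeg rho t)]| = #|[pred rho | podd rho t]|.
  by apply: eq_card => rho; rewrite !inE /podd ht.
by move=> <-; have := even t; rewrite -(pdeg_sum ht) oddD /= addbT negbK.
Qed.

(** Each edge then belongs to exactly one part: an edge from [h] to [t] to that of the only [rho]
    with [podd rho t], any other edge to that of the component it meets. *)
Lemma part_total :
  (forall t, adj h t -> #|[pred rho | podd rho t]| = 1) ->
  \sum_rho \sum_x #|P rho x| = \sum_x #|adj x|.
Proof.
move=> one.
have E rho : \sum_x #|P rho x| =
    \sum_(x | off adj h x) (if fingraph.root (off_adj adj h) x == rho then #|adj x| else 0)
    + \sum_(t | adj h t) pdeg rho t + \sum_(t | adj h t) podd rho t + #|podd rho|.
  rewrite [RHS]addnC (bigD1 h) //=; congr (_ + _).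
    by rewrite part_deg eqxx; case: ifP => // /comp_neqh; rewrite eqxx.
  rewrite -addnA -big_split [LHS](bigID (adj h)) /= [LHS]addnC; congr (_ + _).
    rewrite [RHS]big_mkcond [LHS]big_mkcond; apply: eq_bigr => x _.
    rewrite part_deg /off; have [->|xh] := eqVneq x h => //=.
    by case hx: (adj h x) => //=; rewrite /comp /off xh hx.
  rewrite [RHS]big_mkcond [LHS]big_mkcond; apply: eq_bigr => x _.
  case hx: (adj h x); rewrite ?andbF // andbT part_deg.
  have -> : x == h = false by apply: contraTF hx => /eqP ->; rewrite irr.
  by rewrite hx; case: ifP => // /comp_nhub; rewrite hx.
rewrite (eq_bigr _ (fun rho _ => E rho)) !big_split /=.
rewrite exchange_big [X in _ + X + _ + _]exchange_big /= [X in _ + X + _]exchange_big /=.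
have O1 t : adj h t -> \sum_rho podd rho t = 1.
  by move=> ht; rewrite -[RHS](one t ht) (card_sum (fun rho => podd rho t)).
have -> : \sum_rho #|podd rho| = #|adj h|.
  rewrite -sum1_card (eq_bigr _ (fun rho _ => card_sum (podd rho))) exchange_big /=.
  rewrite [RHS]big_mkcond; apply: eq_bigr => t _ /=; rewrite unfold_in.
  by case: ifP => [/O1//|ht]; rewrite big1 // => rho _; rewrite /podd ht.
rewrite [RHS](bigD1 h) //= addnC; congr (_ + _).
rewrite [RHS](bigID (adj h)) /= [RHS]addnC -addnA -big_split /=; congr (_ + _).
  rewrite [RHS]big_mkcond [LHS]big_mkcond; apply: eq_bigr => x _ /=.
  rewrite -/(off adj h x); case: ifP => // _.
  by rewrite -big_mkcond (big_pred1 (fingraph.root (off_adj adj h) x)) // => rho; rewrite eq_sym.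
rewrite [RHS]big_mkcond [LHS]big_mkcond; apply: eq_bigr => t _.
case ht: (adj h t); rewrite ?andbF //= andbT.
have -> /= : t != h by apply: contraTneq ht => ->; rewrite irr.
by rewrite (O1 _ ht) pdeg_sum.
Qed.

Lemma podd_nbr rho t : podd rho t -> exists2 y, adj t y & D rho y.
Proof.
case/andP=> _; rewrite /pdeg => ot.
have /existsP[y /andP[ty Dy]] : [exists y, adj t y && D rho y]; last by exists y.
apply: contraLR ot; rewrite negb_exists => /forallP n0.
by rewrite big1 // => y _; rewrite (negPf (n0 y)).
Qed.

(** * Tree houses from three components *)

Section Fan.

Hypothesis noOH : ~ odd_hole adj.

(** By [hub_ring] the interior [p] has length 1 modulo 4, so that [rcons p s] has length 2 modulo 4,
    as a leg requires. *)
Lemma fan_leg rho t s : podd rho t -> podd rho s -> t != s ->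
  exists p, [/\ ipath adj (t :: rcons p s), all (D rho) p & leg adj h t (rcons p s)].
Proof.
move=> ot os ts; have [y ty Dy] := podd_nbr ot; have [y' sy' Dy'] := podd_nbr os.
have [/andP[ht _] /andP[hs _]] := (ot, os).
have [p [ip Dp]] := comp_path sym bip ts ht hs ty sy' Dy Dy'.
exists p; split=> //.
have op : all (fun z => (z != h) && ~~ adj h z) p.
  by apply: sub_all Dp => z /andP[].
have := hub_ring bip noOH ip ht hs op => sp.
apply/and4P; split=> //.
- rewrite mem_rcons inE negb_or; apply/andP; split.
    by apply: contraTneq hs => <-; rewrite irr.
  by apply/negP => /(allP op); rewrite eqxx.
- rewrite filter_rcons hs last_rcons (eq_in_filter (a2 := pred0)) ?filter_pred0 //.
  by move=> z /(allP op)/andP[_ /negPf].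
by rewrite size_rcons; move: sp; clear; lia.
Qed.

(** The interiors lie in different components. If an end were adjacent to an interior node of the
    other leg, it would be a third neighbour of that node, against [deg2]. *)
Lemma fan_anti r1 r2 t p1 s1 p2 s2 : r1 != r2 -> s1 != s2 -> s1 != t -> s2 != t ->
  ipath adj (t :: rcons p1 s1) -> ipath adj (t :: rcons p2 s2) ->
  all (D r1) p1 -> all (D r2) p2 -> adj h s1 -> adj h s2 ->
  anti adj (rcons p1 s1) (rcons p2 s2).
Proof.
move=> r12 s12 s1t s2t ip1 ip2 D1 D2 h1 h2.
have mixed r p s s' : ipath adj (t :: rcons p s) -> all (D r) p -> adj h s' ->
    s' != s -> s' != t -> anti1 adj s' p.
  move=> ip Dp hs' ss st; apply/anti1P => y yp; have Dy := allP Dp _ yp.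
  split; first by apply: contraTneq hs' => ->; exact: comp_nhub Dy.
  apply/negP => sy.
  have [u [v [yu yv uv ut vs]]] :=
    path_inner_nbrs sym (ipath_path ip) (ipath_uniq irr ip) yp.
  have nDs z : z \in p -> z != s'.
    by move/(allP Dp)/comp_nhub; apply: contraNneq => ->.
  move: uv; rewrite (deg2 hs' sy (comp_neqh Dy) yu yv) ?eqxx //.
  - by move: ut; rewrite inE => /predU1P[->|/nDs//]; rewrite eq_sym.
  - by move: vs; rewrite mem_rcons inE => /predU1P[->|/nDs//]; rewrite eq_sym.
have s21 : s2 != s1 by rewrite eq_sym.
rewrite -!cats1 anti_catl !anti_catr -!anti1E (antiC sym p1 [:: s2]) -anti1E.
rewrite (mixed _ _ _ _ ip2 D2 h1) // (mixed _ _ _ _ ip1 D1 h2) //.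
rewrite /anti1 /= s12 (hub_nadj bip h1 h2) !andbT.
apply/antiP => x y /(allP D1) Dx /(allP D2) Dy.
have ne : ~ D r1 y.
  by move=> Dy1; move: r12; have [/andP[_ /eqP<-] /andP[_ /eqP<-]] := (Dy, Dy1); rewrite eqxx.
split; first by apply/eqP => E; apply: ne; rewrite -E.
by apply/negP => xy; apply: ne; apply: (comp_adj sym Dx (comp_off Dy) xy).
Qed.

Lemma fan_house t r1 r2 r3 s1 s2 s3 :
  [/\ r1 != r2, r1 != r3 & r2 != r3] -> [/\ s1 != s2, s1 != s3 & s2 != s3] ->
  [/\ podd r1 t, podd r2 t & podd r3 t] -> [/\ podd r1 s1, podd r2 s2 & podd r3 s3] ->
  [/\ t != s1, t != s2 & t != s3] -> tree_house side adj.
Proof.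
move=> [r12 r13 r23] [s12 s13 s23] [t1 t2 t3] [o1 o2 o3] [ts1 ts2 ts3].
have [p1 [ip1 D1 L1]] := fan_leg t1 o1 ts1.
have [p2 [ip2 D2 L2]] := fan_leg t2 o2 ts2.
have [p3 [ip3 D3 L3]] := fan_leg t3 o3 ts3.
have [/andP[ht _] /andP[h1 _] /andP[h2 _] /andP[h3 _]] := And4 t1 o1 o2 o3.
exists h, t, (rcons p1 s1), (rcons p2 s2), (rcons p3 s3).
rewrite /house side_h ht L1 L2 L3 /=; apply/and4P; split.
- by apply: contraTneq ht => ->; rewrite irr.
- by apply: (fan_anti r12 s12 _ _ ip1 ip2 D1 D2) => //; rewrite eq_sym.
- by apply: (fan_anti r13 s13 _ _ ip1 ip3 D1 D3) => //; rewrite eq_sym.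
- by apply: (fan_anti r23 s23 _ _ ip2 ip3 D2 D3) => //; rewrite eq_sym.
Qed.

End Fan.

(* The edges meeting one of the two components and the remaining edges form two
   smaller induced subgraphs with even degrees. *)
Lemma twin_split rho1 rho2 t :
  (forall adj', bigraph adj' -> \sum_x #|adj' x| < \sum_x #|adj x| ->
     ~ odd_hole adj' -> ~ tree_house side adj' -> 8 %| \sum_x #|adj' x|) ->
  ~ odd_hole adj -> ~ tree_house side adj ->
  rho1 != rho2 -> podd rho1 =1 podd rho2 -> podd rho1 t ->
  8 %| \sum_x #|adj x|.
Proof.
move=> IH noOH noTH r12 O12 ot.
pose U x := D rho1 x || D rho2 x.
pose aU : rel N := fun x y => adj x y && (U x || U y).
pose aR : rel N := fun x y => adj x y && ~~ (U x || U y).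
have symU : symmetric aU by move=> x y; rewrite /aU sym orbC.
have symR : symmetric aR by move=> x y; rewrite /aR sym orbC.
have subU x y : aU x y -> adj x y by case/andP.
have subR x y : aR x y -> adj x y by case/andP.
have degUR x : #|adj x| = #|aU x| + #|aR x|.
  rewrite !card_sum -big_split; apply: eq_bigr => y _ /=.
  by rewrite /aU /aR; case: (adj x y); case: (U x || U y).
have Uh : ~~ U h by apply/negP => /orP[] /comp_neqh; rewrite eqxx.
have UN x y : U x -> adj x y -> U y || adj h y.
  by case/orP=> /comp_nbr H /H; rewrite /U; case/orP=> ->; rewrite ?orbT.
have D12 x : D rho1 x -> D rho2 x = false.
  move=> D1; apply: contraNF r12 => D2.
  by have [/andP[_ /eqP<-] /andP[_ /eqP<-]] := (D1, D2).
have evenU x : ~~ odd #|aU x|.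
  have [Ux|Ux] := boolP (U x).
    rewrite (_ : #|aU x| = #|adj x|) ?even //; apply: eq_card => y.
    by rewrite -[LHS]/(aU x y) -[RHS]/(adj x y) /aU Ux andbT.
  have -> : #|aU x| = pdeg rho1 x + pdeg rho2 x.
    rewrite card_sum -big_split; apply: eq_bigr => y _ /=.
    rewrite /aU (negPf Ux) /U; case: (adj x y) => //=.
    by case D1: (D rho1 y); rewrite // (D12 _ D1).
  move: Ux; rewrite /U negb_or => /andP[nD1 nD2].
  (* By [O12] the numbers of neighbours of [x] in the two components have the same parity. *)
  have [hx|hx] := boolP (adj h x); last by rewrite !pdeg0.
  by have := O12 x; rewrite /podd hx /= oddD => ->; rewrite addbb.
have evenR x : ~~ odd #|aR x|.
  by have := even x; rewrite degUR oddD (negPf (evenU x)).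
have total : \sum_x #|adj x| = \sum_x #|aU x| + \sum_x #|aR x|.
  by rewrite -big_split; apply: eq_bigr => x _; exact: degUR.
have pos (a : rel N) x y : a x y -> 0 < \sum_x #|a x|.
  move=> axy; rewrite (bigD1 x) //= addn_gt0; apply/orP; left.
  by apply/card_gt0P; exists y.
have posU : 0 < \sum_x #|aU x|.
  have [y ty Dy] := podd_nbr ot; apply: (pos _ t y).
  by rewrite /aU ty /U Dy !orbT.
have posR : 0 < \sum_x #|aR x|.
  have /andP[ht _] := ot; apply: (pos _ h t).
  rewrite /aR ht (negPf Uh) /=; apply/negP => /orP[] /comp_nhub;
  by rewrite ht.
have indU x x' y y' : aU x x' -> aU y y' -> adj x y -> aU x y.
  move=> ax ay xy; rewrite /aU xy /=.
  have T z z' : aU z z' -> U z || adj h z.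
    case/andP=> zz' /orP[->//|Uz']; apply: (UN z') => //; by rewrite sym.
  have := T _ _ ax; have := T _ _ ay; case: (U x); case: (U y) => //= hy hx.
  by have := hub_nadj bip hx hy; rewrite xy.
have indR x x' y y' : aR x x' -> aR y y' -> adj x y -> aR x y.
  by case/andP=> _ /norP[nx _] /andP[_ /norP[ny _]] xy; rewrite /aR xy (negPf nx) (negPf ny).
have bipU x y : aU x y -> side x = ~~ side y by move/subU/bip.
have bipR x y : aR x y -> side x = ~~ side y by move/subR/bip.
rewrite total dvdn_addr; apply: IH.
- exact: sub_bigraph subR symR evenR.
- by rewrite total -[X in X < _]add0n ltn_add2r.
- by move/(induced_odd_hole symR bipR subR indR).
- by move/(induced_tree_house symR subR indR).
- exact: sub_bigraph subU symU evenU.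
- by rewrite total -[X in X < _]addn0 ltn_add2l.
- by move/(induced_odd_hole symU bipU subU indU).
- by move/(induced_tree_house symU subU indU).
Qed.

End HubParts.

Theorem bigraph_dvd8 (adj : rel N) : bigraph adj ->
  ~ odd_hole adj -> ~ tree_house side adj -> 8 %| \sum_x #|adj x|.
Proof.
have [n] := ubnP (\sum_x #|adj x|); elim: n adj => // n IH adj le big noOH noTH.
have [sym bip even _] := big; have irr := bip_irr bip.
case: (peel_cycles sym bip even) => // -[c oc].
apply: contraT => n8; exfalso.
(* It remains to verify [no_chorded]: an induced path with three neighbours of [h] allows the
   induction to run through the parts at [h]. *)
apply: (no_odd_cycle sym bip (bigraph_hub2 big) noOH _ oc) => {c oc} h b m a l c.
move=> sh hout ip hb ha hc.
have uq := ipath_uniq irr ip.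
have dh : 2 < #|adj h|.
  apply/card_gt2P; exists b, a, c; split; first by split.
  move: uq; rewrite cons_uniq mem_cat negb_or in_cons negb_or => /andP[/and3P[_ ba bl]].
  rewrite cat_uniq => /and3P[_ _ /andP[al _]]; split=> //.
  - by apply: contraNneq al => ->; rewrite mem_rcons mem_head.
  - by apply: contraNneq bl => <-; rewrite mem_rcons mem_head.
have deg2 := bigraph_hub2 big sh dh.
have IH' adj' : bigraph adj' -> \sum_x #|adj' x| < \sum_x #|adj x| ->
     ~ odd_hole adj' -> ~ tree_house side adj' -> 8 %| \sum_x #|adj' x|.
  by move=> B lt; apply: IH => //; apply: leq_trans lt _.
pose P rho := part adj h rho (podd adj h rho).
have P8 rho : 8 %| \sum_x #|P rho x|.
  apply: IH'; first exact: part_bigraph.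
  (* By [ipath_three] some node [z] of the path is neither in the component nor a neighbour of [h].
     It is isolated in the part but not in [adj], so the part has a smaller degree sum. *)
  - have [z [zs Dz hz]] : exists z, [/\ z \in b :: m ++ a :: rcons l c,
        ~~ comp adj h rho z & ~~ adj h z].
      have [al|] := boolP (all (fun z => comp adj h rho z || adj h z) (b :: m ++ a :: rcons l c)).
        case: (ipath_three sym bip deg2 noOH ip al).
        rewrite /= count_cat /= -cats1 count_cat /= hb ha hc.
        by clear; lia.
      by case/allPn=> z zs; rewrite negb_or => /andP[? ?]; exists z.
    rewrite (bigD1 z) //= [X in _ < X](bigD1 z) //= -addSn leq_add //.
      rewrite part_deg // (negPf Dz) (negPf hz).
      have -> : z == h = false by apply: contraNF hout => /eqP <-.
      apply/card_gt0P; have [|y _ zy] := ipath_nbr sym ip _ zs; last by exists y.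
      by rewrite /= size_cat /= size_rcons !addnS.
    by apply: leq_sum => x _; apply: subset_leq_card; apply/subsetP => y; exact: part_adj.
  - exact: (part_oddhole sym bip deg2 noOH).
  - exact: (part_house sym bip deg2 noOH sh noTH).
have one t : adj h t -> #|[pred rho | podd adj h rho t]| = 1.
  move=> ht; have o := podd_count_odd big ht.
  apply: contraTeq o => n1; apply/negP => o.
  have /card_gt2P[r1 [r2 [r3 [[o1 o2 o3] [r12 r23 r31]]]]] :
      2 < #|[pred rho | podd adj h rho t]|.
    by case: #|_| n1 o => [|[|[|k]]].
  (* Without [t], the three sets have odd size, and by [twin_split] they are pairwise distinct.
     Distinct representatives are the ends of the legs of a tree house with root [t]. *)
  pose A rho := [set s | podd adj h rho s] :\ t.
  have oA rho : podd adj h rho t -> odd #|A rho|.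
    move=> ot; have := podd_even h big rho.
    have -> : #|podd adj h rho| = #|[set s | podd adj h rho s]|.
      by apply: eq_card => s; rewrite inE.
    by rewrite (cardsD1 t) inE ot /= negbK.
  have nA rho rho' : podd adj h rho t -> podd adj h rho' t -> rho != rho' -> A rho != A rho'.
    move=> ot ot' rr; apply/eqP => E; move/negP: n8; apply.
    apply: (twin_split big IH' noOH noTH rr _ ot) => s.
    have [->|st] := eqVneq s t; first by rewrite ot ot'.
    by have /setP/(_ s) := E; rewrite !inE st.
  rewrite !inE in o1 o2 o3.
  have [||||||s1 [s2 [s3 [[A1 A2 A3] S]]]] := @distinct_reps _ (A r1) (A r2) (A r3).
  - exact: oA.
  - exact: oA.
  - exact: oA.
  - exact: nA.
  - by apply: nA; rewrite // eq_sym.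
  - exact: nA.
  move: A1 A2 A3; rewrite !inE => /andP[t1 A1] /andP[t2 A2] /andP[t3 A3].
  apply: noTH; apply: (@fan_house adj h big sh dh noOH t r1 r2 r3 s1 s2 s3) => //.
  - by split=> //; rewrite eq_sym.
  - by split; rewrite eq_sym.
move/negP: n8; apply; rewrite -(part_total big one); apply: dvdn_sum => rho _; exact: P8.
Qed.

End EvenBigraphs.

(** * Minimal matrices that are not totally unimodular *)

Section UnitMinors.

Local Open Scope ring_scope.

Lemma dvdz_small (c u z : int) : z = c * u -> `|z| <= 1 -> 1 < `|c| -> z = 0.
Proof.
move=> -> le lt; apply/eqP; rewrite mulf_eq0; apply/orP; right.
by apply: contraLR le => u0; rewrite normrM -ltNge; nia.
Qed.

(* A unit minor avoiding column [i0] determines [z] from its rows of [M *m z], so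
   [c] divides [z]. *)
Lemma unit_minors_ker n (M : 'M[int]_n.+1) (z w : 'cV[int]_n.+1) c i0 :
  (forall i j, \det (row' i (col' j M)) \in [:: 0; 1; -1]) -> \det M != 0 ->
  (forall i, `|z i 0| <= 1) -> M *m z = c *: w -> z i0 0 = 0 -> 1 < `|c| -> z = 0.
Proof.
move=> min dM zle Mz z0 c1.
have [i1 ci1] : exists i1, cofactor M i1 i0 != 0.
  apply/existsP; apply: contraNT dM; rewrite negb_exists => /forallP c0.
  rewrite (expand_det_col M i0) big1 // => i _.
  by have := c0 i; rewrite negbK => /eqP->; rewrite mulr0.
pose Q := row' i1 (col' i0 M).
have dQ : \det Q * \det Q = 1.
  have := min i1 i0; rewrite -/Q !inE => /or3P[] /eqP E; rewrite E ?mulr1 ?mulrNN ?mulr1 //.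
  by move: ci1; rewrite /cofactor -/Q E mulr0 eqxx.
have Qz : Q *m row' i0 z = c *: row' i1 w.
  apply/colP => i; have /colP/(_ (lift i1 i)) := Mz; rewrite !mxE => <-.
  rewrite (bigD1_ord i0) //= z0 mulr0 add0r.
  by apply: eq_bigr => j _; rewrite !mxE.
have z' : row' i0 z = c *: (\det Q *: (\adj Q *m row' i1 w)).
  rewrite -[LHS]scale1r -dQ -scalerA -[X in _ *: X]mul_scalar_mx -mul_adj_mx.
  by rewrite -mulmxA Qz -scalemxAr scalerA mulrC -scalerA.
apply/colP => i; rewrite mxE; case: (unliftP i0 i) => [j ->|->//].
have /colP/(_ j) := z'; rewrite !mxE => zj.
exact: dvdz_small zj (zle _) c1.
Qed.

(** * Camion's argument on the adjugate *)

Section Camion.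

Variables (n : nat) (M : 'M[int]_n.+2).
Hypothesis minors : forall i j, \det (row' i (col' j M)) \in [:: 0; 1; -1].
Hypothesis detM : \det M \notin [:: 0; 1; -1].

Let d := \det M.

Let d0 : d != 0.
Proof. by apply: contraNneq detM => E; rewrite -/d E inE eqxx. Qed.

Let d1 : 1 < `|d|.
Proof. by move: detM; rewrite -/d !inE; lia. Qed.

Let A := \adj M.

Lemma adj_le1 i j : `|A i j| <= 1.
Proof.
rewrite /A mxE /cofactor normrMsign.
by have := minors j i; rewrite !inE => /or3P[] /eqP->.
Qed.

Lemma adj_col j : M *m col j A = d *: col j 1%:M.
Proof.
rewrite colE mulmxA mul_mx_adj mul_scalar_mx; congr (_ *: _).
by rewrite colE mul1mx.
Qed.

(** If an entry vanished, [unit_minors_ker] with [c = d] would make its whole column zero, but [M]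
    maps this column to [d] times a unit vector. *)
Lemma adj_norm i j : `|A i j| = 1.
Proof.
apply/eqP; rewrite eq_le adj_le1 /=; rewrite -gtz0_ge1 normr_gt0; apply/eqP => A0.
have Aj : col j A = 0.
  by apply: (@unit_minors_ker _ _ _ _ d i minors d0 _ (adj_col j) _ d1) => [k|];
    rewrite mxE ?adj_le1.
have /colP/(_ j) := adj_col j; rewrite Aj mulmx0 !mxE eqxx mulr1 => E.
by move: d0; rewrite -E eqxx.
Qed.

Lemma adj_pm i j : A i j = 1 \/ A i j = -1.
Proof. by have := adj_norm i j; lia. Qed.

(** Half the sum of the first two columns of the adjugate is a vector [z] with entries 0, 1 or -1,
    which [M] maps to [c] times a sum of two unit vectors, where [d] is twice [c]. These columns
    differ, so [z] has a zero entry, and if [c] were not a unit, [unit_minors_ker] would give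
    [z = 0]. *)
Lemma det_norm : `|d| = 2.
Proof.
move: adj_pm adj_le1 adj_col; move: (A) => B pm le1 Bcol.
pose z : 'cV[int]_n.+2 := \col_i (if B i 0 == B i 1 then B i 0 else 0).
have z2 : z *+ 2 = col 0 B + col 1 B.
  rewrite mulr2n; apply/colP => i; rewrite !mxE; case: eqP => [->//|].
  by have := pm i 0; have := pm i 1; lia.
have Mz2 : (M *m z) *+ 2 = d *: (col 0 1%:M + col 1 1%:M).
  by rewrite mulr2n -mulmxDr -mulr2n z2 mulmxDr !Bcol scalerDr.
pose c := (M *m z) 0 0.
have dc : d = c *+ 2.
  by have /colP/(_ 0) := Mz2; rewrite /c mulr2n !mxE /= addr0 mulr1 => <-.
have Mz : M *m z = c *: (col 0 1%:M + col 1 1%:M).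
  apply/colP => i; have /colP/(_ i) := Mz2; rewrite dc.
  by rewrite !mulr2n scalerDl !mxE; clear; lia.
have [i0 z0] : exists i, B i 0 != B i 1.
  apply/existsP; apply: contraT; rewrite negb_exists => /forallP eqA.
  have E : col 0 B = col 1 B by apply/colP => i; rewrite !mxE; apply/eqP/negPn/eqA.
  have := Bcol 0; rewrite E Bcol => /colP/(_ 0); rewrite !mxE /= mulr0 mulr1 => E'.
  by move: d0; rewrite -E' eqxx.
have c0 : c != 0 by apply: contraNneq d0 => E; rewrite dc E.
have [c1|c1] := ltP 1 `|c|; last by rewrite dc; move: c0 c1; clear; lia.
have z0' : z = 0.
  apply: (@unit_minors_ker _ _ _ _ c i0 minors d0 _ Mz _ c1) => [k|]; rewrite mxE.
    by case: ifP => _; rewrite ?le1.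
  by rewrite (negPf z0).
have := Mz; rewrite z0' mulmx0 => /colP/(_ 0); rewrite !mxE /= addr0 mulr1 => E.
by move: c0; rewrite -E eqxx.
Qed.

Lemma adj_colE i k : \sum_j M i j * A j k = d *+ (i == k).
Proof.
have /matrixP/(_ i k) := mul_mx_adj M; rewrite !mxE => <-.
by apply: eq_bigr => j _.
Qed.

Lemma adj_rowE k j : \sum_i A k i * M i j = d *+ (k == j).
Proof.
have /matrixP/(_ k j) := mul_adj_mx M; rewrite !mxE => <-.
by apply: eq_bigr => i _.
Qed.

Let dvd_d b : (2 %| d *+ b)%Z.
Proof. by have := det_norm; case: b; rewrite ?mulr1n ?mulr0n; lia. Qed.

Let dvd_pm i j : (2 %| 1 - A i j)%Z.
Proof. by case: (adj_pm i j) => ->. Qed.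

(** All [A j 0] are odd, so modulo 2 the sum is an entry of [M *m A], that is, 0 or [d]. *)
Lemma row_sum_even i : (2 %| \sum_j M i j)%Z.
Proof.
rewrite (eq_bigr (fun j => M i j * (1 - A j 0) + M i j * A j 0)); last first.
  by move=> j _; rewrite -mulrDr subrK mulr1.
by rewrite big_split rpredD //= ?adj_colE // rpred_sum // => j _; rewrite dvdz_mull.
Qed.

Lemma col_sum_even j : (2 %| \sum_i M i j)%Z.
Proof.
rewrite (eq_bigr (fun i => (1 - A 0 i) * M i j + A 0 i * M i j)); last first.
  by move=> i _; rewrite -mulrDl subrK mul1r.
by rewrite big_split rpredD //= ?adj_rowE // rpred_sum // => i _; rewrite dvdz_mulr.
Qed.

(** Weighting row [i] by [A 0 i], and then column [j] by [A j 0], changes the total by multiples of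
    4, since even sums are multiplied by even numbers. The weighted total is [d * A 0 0], which is 2
    or -2. *)
Lemma total_sum_mod4 : ~~ (4 %| \sum_i \sum_j M i j)%Z.
Proof.
have E : \sum_i \sum_j M i j =
    \sum_i (1 - A 0 i) * (\sum_j M i j) +
    (\sum_j (\sum_i A 0 i * M i j) * (1 - A j 0) + d * A 0 0).
  have -> : d * A 0 0 = \sum_j (\sum_i A 0 i * M i j) * A j 0.
    rewrite (bigD1 0) //= adj_rowE eqxx big1 ?addr0 // => j j0.
    by rewrite adj_rowE eq_sym (negPf j0) mul0r.
  rewrite -big_split /= [X in _ + X](_ : _ = \sum_i A 0 i * \sum_j M i j).
    by rewrite -big_split; apply: eq_bigr => i _; rewrite /= -mulrDl subrK mul1r.
  under eq_bigr do rewrite -mulrDr subrK mulr1.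
  by rewrite exchange_big; apply: eq_bigr => i _; rewrite mulr_sumr.
have d1' : (4 %| \sum_i (1 - A 0 i) * (\sum_j M i j))%Z.
  by apply: rpred_sum => i _; apply: (@dvdz_mul 2 2) => //; exact: row_sum_even.
have d2' : (4 %| \sum_j (\sum_i A 0 i * M i j) * (1 - A j 0))%Z.
  by apply: rpred_sum => j _; rewrite adj_rowE; apply: (@dvdz_mul 2 2).
rewrite E rpredDl // rpredDl //.
have [->|->] : d = 2 \/ d = -2 by have := det_norm; clear; lia.
  by case: (adj_pm 0 0) => ->.
by case: (adj_pm 0 0) => ->.
Qed.

End Camion.

(** The row of column sums is [2 *: w]. If [M] were invertible over the integers, the all-ones row
    would be [2 *: (w *m invmx M)], although 1 is odd. *)
Lemma even_cols_det n (M : 'M[int]_n.+1) :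
  (forall j, (2 %| \sum_i M i j)%Z) -> (forall x : 'rV_n.+1, x *m M = 0 -> x = 0) ->
  \det M \notin [:: 0; 1; -1].
Proof.
move=> even ker; apply/negP; rewrite !inE => dM.
have d0 : \det M != 0.
  by apply/negP => /det0P[x x0 /ker xe]; rewrite xe eqxx in x0.
have uM : M \in unitmx.
  by rewrite unitmxE; move: dM; rewrite (negPf d0) /= => /orP[] /eqP->.
pose w : 'rV[int]_n.+1 := \row_j ((\sum_i M i j) %/ 2)%Z.
have uw : const_mx 1 *m M = 2 *: w.
  apply/rowP => j; rewrite !mxE mulrC divzK //.
  by apply: eq_bigr => i _; rewrite mxE mul1r.
have /rowP/(_ 0) : const_mx 1 = 2 *: (w *m invmx M).
  by rewrite scalemxAl -uw mulmxK.
by rewrite [LHS]mxE mxE; lia.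
Qed.

End UnitMinors.

(** * Odd cycles and tree houses are not unimodular *)

(** Containment without subtypes: the set [W] is recovered as the image of [f]. *)
Lemma containsP (V V' : finType) (G : hypergraph V) (H : hypergraph V') :
  contains G H <->
  exists (f : V' -> V) (g : hyperedge H -> hyperedge G),
    [/\ injective f, injective g & forall v e, (f v \in vset (g e)) = (v \in vset e)].
Proof.
split=> [[W [H' [[iota inj_iota Hiota] [phi [psi [bij_phi bij_psi Hpsi]]]]]]|].
  exists (fun v => val (phi v)), (fun e => iota (psi e)); split.
  - by move=> x y /val_inj/(bij_inj bij_phi).
  - by move=> x y /inj_iota/(bij_inj bij_psi).
  move=> v e; have /setP/(_ (val (phi v))) := Hiota (psi e).
  rewrite inE (valP (phi v)) andbT => <-.
  by rewrite mem_imset ?Hpsi ?mem_imset //; [exact: bij_inj | exact: val_inj].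
move=> [f [g [inj_f inj_g Hfg]]].
pose W := f @: [set: V'].
have fW v : f v \in W by exact: imset_f.
pose phi v : {x | x \in W} := Sub (f v) (fW v).
have inj_phi : injective phi by move=> x y /(congr1 val) /= /inj_f.
have ne (e : hyperedge H) : phi @: vset e != set0 by rewrite imset_eq0 vset_neq0.
exists W, (Hypergraph ne); split.
  exists g => // e; apply/setP => x; rewrite inE; apply/imsetP/andP => [[y /imsetP[v ve ->] ->]|].
    by rewrite /= Hfg.
  case=> + /imsetP[v _ Ex]; rewrite Ex Hfg => ve.
  by exists (phi v) => //; exact: imset_f.
exists phi, id; split=> //; last by exists id.
apply: inj_card_bij => //; rewrite card_sub.
by rewrite -[in X in _ <= X]cardsT -(card_imset _ inj_f); apply: eq_leq; apply: eq_card.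
Qed.

(** * A model of the cycles *)

Section StandardCycle.

Variable n : nat.

Definition cycle_vset (j : 'I_n) : {set 'I_n} := [set j; ordS j].

Lemma cycle_vset_neq0 j : cycle_vset j != set0.
Proof. by apply/set0Pn; exists j; rewrite !inE eqxx. Qed.

Definition std_cycle : hypergraph 'I_n := Hypergraph cycle_vset_neq0.

Lemma std_cycleP : 1 < n -> is_cycle n std_cycle.
Proof. by move=> n1; split=> //; exists id, id; split=> //; exists id. Qed.

Lemma ordS_neq (j : 'I_n) : 1 < n -> j != ordS j.
Proof.
move=> n1; rewrite -val_eqE /=; have := ltn_ord j; rewrite leq_eqVlt => /predU1P[E|lt].
  by rewrite E modnn; apply: contraTneq n1 => j0; rewrite -E j0.
by rewrite modn_small // neq_ltn ltnSn.
Qed.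

Lemma iter_ordS k (j : 'I_n) : val (iter k (@ordS n) j) = (j + k) %% n.
Proof.
elim: k => [|k IH]; first by rewrite addn0 modn_small.
by rewrite iterS /= IH -addn1 modnDml addn1 addnS.
Qed.

(** [X] changes sign at each step, so going once round the odd cycle gives [X i = - X i]. *)
Lemma cycle_kernel (X : 'I_n -> int) : odd n -> 1 < n ->
  (forall j, \sum_(i in cycle_vset j) X i = 0)%R -> forall i, X i = 0%R.
Proof.
move=> on n1 H i.
have S j : X (ordS j) = (- X j)%R.
  have := H j; rewrite /cycle_vset big_setU1 ?inE ?ordS_neq // big_set1 /=.
  by move/eqP; rewrite addrC addr_eq0 => /eqP.
have I k : X (iter k (@ordS n) i) = ((-1) ^+ k * X i)%R.
  by elim: k => [|k IH]; rewrite ?mul1r // iterS S IH exprS mulN1r mulNr.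
have := I n; rewrite -signr_odd on expr1 mulN1r (_ : iter n _ i = i); first by lia.
by apply: val_inj; rewrite iter_ordS modnDr modn_small.
Qed.

End StandardCycle.

(** * A model of the tree houses *)

Section StandardHouse.

Variable n : 'I_3 -> nat.
Hypothesis odd_n : forall i, odd (n i).

Notation node := (option {i : 'I_3 & 'I_(n i)}).

(* As a vertex, [None] is the root and [Some (i, k)] is the vertex at distance
   [k + 1] from it on the path [i]; as a hyperedge, [None] is the hub and any
   other node stands for the edge to its parent. *)
Definition Node i (k : 'I_(n i)) : node := Some (Tagged (fun i => 'I_(n i)) k).

(** The inner match returns a function of [lt], so that the bound for the predecessor can be
    obtained from it. *)
Definition parent (u : {i : 'I_3 & 'I_(n i)}) : node :=
  let: existT i (Ordinal m lt) := u in
  (if m is m'.+1 return m < n i -> node then fun lt => Node (Ordinal (ltnW lt))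
   else fun=> None) lt.

Definition depth (x : node) : nat := if x is Some u then (tagged u).+1 else 0.

Definition is_end (x : node) : bool :=
  if x is Some u then (tagged u).+1 == n (tag u) else true.

Definition house_vset (y : node) : {set node} :=
  if y is Some u then [set parent u; Some u] else [set x | is_end x].

Lemma house_vset_neq0 y : house_vset y != set0.
Proof.
by apply/set0Pn; exists y; case: y => [u|]; rewrite !inE ?eqxx ?orbT.
Qed.

Definition std_house : hypergraph node := Hypergraph house_vset_neq0.

Lemma depth_parent u : (depth (parent u)).+1 = depth (Some u).
Proof. by case: u => i [[|m] lt]. Qed.

Lemma parent_neq u : parent u != Some u.
Proof. by apply/eqP => E; have := depth_parent u; rewrite E => /eqP; rewrite gtn_eqF. Qed.

Lemma n_gt0 i : 0 < n i.
Proof. by case: (n i) (odd_n i). Qed.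

Lemma last_lt i : (n i).-1 < n i.
Proof. by rewrite prednK ?n_gt0. Qed.

Definition leaf i : node := Node (Ordinal (last_lt i)).

Lemma leaf_inj : injective leaf.
Proof. by move=> i j []. Qed.

Lemma house_hub : house_vset None = None |: [set leaf i | i : 'I_3].
Proof.
apply/setP => x; rewrite !inE; case: x => [[i k]|] //=.
apply/eqP/imsetP => [E|[j _ E]].
  exists i => //; rewrite /leaf /Node; congr Some; congr existT.
  by apply: val_inj => /=; apply: succn_inj; rewrite prednK ?n_gt0.
have /= Ei := congr1 (fun x : node => if x is Some u then tag u else i) E.
by have /= -> := congr1 depth E; rewrite prednK ?n_gt0 // Ei.
Qed.

Lemma card_house_vset y : #|house_vset y| = if y is Some _ then 2 else 4.
Proof.
case: y => [u|]; first by rewrite cards2 parent_neq.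
rewrite house_hub cardsU1 card_imset ?card_ord; last exact: leaf_inj.
by rewrite (_ : _ \notin _) //; apply/imsetP => -[].
Qed.

Lemma house_vset_inj : injective house_vset.
Proof.
move=> x y E; have := card_house_vset x; rewrite E card_house_vset.
case: x y E => [u|] [u'|] //= E _.
have := setU11 (parent u) [set Some u]; have := set22 (parent u) (Some u).
rewrite E; have := set22 (parent u') (Some u'); rewrite -{1}E !inE.
case/orP=> /eqP // E1 /orP[]/eqP // E2; have := depth_parent u; rewrite -E1 E2.
by have := depth_parent u'; lia.
Qed.

(** [X] changes sign between a node and its parent. The leaves have odd depth, so the sum over the
    hub is [X None - 3 * X None], which forces [X None = 0]. *)
Lemma house_kernel (X : node -> int) :
  (forall y, \sum_(x in house_vset y) X x = 0)%R -> forall x, X x = 0%R.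
Proof.
move=> H.
have S u : X (Some u) = (- X (parent u))%R.
  have := H (Some u); rewrite /= big_setU1 ?inE ?parent_neq // big_set1 /=.
  by move/eqP; rewrite addrC addr_eq0 => /eqP.
have I x : X x = ((-1) ^+ (depth x) * X None)%R.
  have [d] := ubnP (depth x); elim: d x => // d IH [u|] lt; last by rewrite mul1r.
  rewrite S IH; last by move: lt; rewrite -depth_parent.
  by rewrite -depth_parent exprS mulN1r mulNr.
suff X0 : X None = 0%R by move=> x; rewrite I X0 mulr0.
have := H None; rewrite house_hub big_setU1 /=; last by apply/imsetP => -[].
rewrite big_imset /=; last by move=> i j _ _; exact: leaf_inj.
rewrite (eq_bigr (fun=> - X None)%R) => [|i _].
  by rewrite sumr_const card_ord; lia.
by rewrite I /= prednK ?n_gt0 // -signr_odd odd_n mulN1r.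
Qed.

End StandardHouse.

(** Rows and columns are numbered by the same bijection [e] from ordinals to [K]; the resulting
    square submatrix satisfies [even_cols_det]. *)
Lemma kernel_not_unimodular (V K : finType) (G : hypergraph V) (S : K -> {set K})
    (f : K -> V) (g : K -> hyperedge G) :
  injective f -> injective g -> (forall x y, (f x \in vset (g y)) = (x \in S y)) ->
  0 < #|K| -> (forall y, ~~ odd #|S y|) ->
  (forall X : K -> int, (forall y, \sum_(x in S y) X x = 0)%R -> forall x, X x = 0%R) ->
  ~ unimodular G.
Proof.
move=> inj_f inj_g fg K0 evenS ker uni.
have [k Ek] : exists k, #|K| = k.+1 by exists #|K|.-1; rewrite prednK.
pose e (i : 'I_k.+1) : K := enum_val (cast_ord (esym Ek) i).
pose e' (x : K) : 'I_k.+1 := cast_ord Ek (enum_rank x).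
have eK : cancel e e' by move=> i; rewrite /e /e' enum_valK cast_ordKV.
have e'K : cancel e' e by move=> x; rewrite /e /e' cast_ordK enum_rankK.
have bij_e : {on [pred _ | true], bijective e} by exists e' => x _.
have inj_e := can_inj eK.
pose F i := enum_rank (f (e i)); pose C j := enum_rank (g (e j)).
have inj_F : injective F by move=> i j /enum_rank_inj/inj_f/inj_e.
have inj_C : injective C by move=> i j /enum_rank_inj/inj_g/inj_e.
have ME i j : mxsub F C (incidence_mx G) i j = (e i \in S (e j))%:R%R.
  by rewrite !mxE !enum_rankK fg.
have := uni _ F C inj_F inj_C; apply/negP/even_cols_det => [j|x xM].
  rewrite (eq_bigr _ (fun i _ => ME i j)).
  rewrite (reindex e') /=; last by exists e => y _.
  under eq_bigr do rewrite e'K.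
  rewrite -natr_sum -big_mkcond sum1_card.
  by rewrite natz dvdzE /= dvdn2 evenS.
apply/rowP => i; rewrite mxE -[i]eK.
pose X y := x 0%R (e' y); rewrite -/(X (e i)); apply: ker => y.
have /rowP/(_ (e' y)) := xM; rewrite !mxE.
rewrite (reindex e') /=; last by exists e => z _.
move=> E; rewrite -[RHS]E big_mkcond; apply: eq_bigr => z _.
by rewrite ME !e'K; case: ifP => _; rewrite ?mulr1 ?mulr0.
Qed.

Lemma odd_cycle_not_unimodular (V : finType) (G : hypergraph V) :
  contains_odd_cycle G -> ~ unimodular G.
Proof.
move=> [V' [C [[n on [n1 [v [e [bv be ve]]]]] /containsP[f [g [inj_f inj_g fg]]]]]].
apply: (@kernel_not_unimodular _ _ _ (@cycle_vset n) (f \o v) (g \o e)).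
- by apply: inj_comp => //; exact: bij_inj.
- by apply: inj_comp => //; exact: bij_inj.
- move=> i j; rewrite /= fg ve !inE.
  by rewrite !(inj_eq (bij_inj bv)).
- by rewrite card_ord (ltn_trans _ n1).
- by move=> j; rewrite cards2 ordS_neq.
- by move=> X; exact: cycle_kernel.
Qed.

(** The node [(i, k)] goes to vertex [k + 1] and edge [k] of the path [i]. On vertices this is
    injective because the paths are disjoint outside the root. *)
Lemma tree_house_std (V : finType) (T : hypergraph V) : is_tree_house T ->
  exists n : 'I_3 -> nat, (forall i, odd (n i)) /\
  exists (f : option {i : 'I_3 & 'I_(n i)} -> V)
         (g : option {i : 'I_3 & 'I_(n i)} -> hyperedge T),
    [/\ injective f, injective g & forall y, vset (g y) = f @: house_vset y].
Proof.
move=> [h [r [l [n [v [e [[hE h4] _ path _ disj]]]]]]].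
have on i : odd (n i) by case: (path i).
have inj_v i : injective (v i) by case: (path i) => _ [].
have v0 i : v i ord0 = r by case: (path i) => _ [].
have vmax i : v i ord_max = l i by case: (path i) => _ [].
exists n; split=> //.
pose f (x : option {i : 'I_3 & 'I_(n i)}) :=
  if x is Some u then v (tag u) (lift ord0 (tagged u)) else r.
pose g (x : option {i : 'I_3 & 'I_(n i)}) :=
  if x is Some u then val (e (tag u) (tagged u)) else h.
have fN i (k : 'I_(n i)) : f (Some (Tagged _ k)) != r.
  by rewrite -(v0 i) (inj_eq (inj_v i)).
have f_parent u : f (parent u) = v (tag u) (widen_ord (leqnSn _) (tagged u)).
  case: u => i [[|m] lt] /=; last by congr (v i _); exact: val_inj.
  by rewrite -(v0 i); congr (v i _); exact: val_inj.
have inj_f : injective f.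
  move=> [[i k]|] [[j m]|] //; last 2 first.
  - by move=> E; have := fN i k; rewrite E eqxx.
  - by move=> E; have := fN j m; rewrite -E eqxx.
  have [ij|ij] := eqVneq i j.
    by subst j => /= /inj_v/lift_inj ->.
  have inD i' (k' : 'I_(n i')) :
      f (Some (Tagged _ k')) \in [set v i' m' | m' in 'I_(n i').+1] :\ r.
    by rewrite in_setD1 fN /=; apply: imset_f.
  by move=> E; have := disjointFr (disj i j ij) (inD i k); rewrite E inD.
have gE y : vset (g y) = f @: house_vset y.
  case: y => [u|].
    rewrite /= imsetU1 imset_set1 f_parent /=.
    by case: (path (tag u)) => _ [_ _ _ H]; exact: H.
  rewrite (house_hub on) imsetU1 [LHS]hE; congr (_ |: _).
  rewrite -imset_comp; apply: eq_imset => i /=; rewrite -vmax; congr (v i _).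
  by apply: val_inj => /=; rewrite /bump add1n prednK // n_gt0.
(* [g] is injective because distinct hyperedges of the model are distinct sets, which [f] keeps
   apart. *)
exists f, g; split=> // x y E.
apply: (house_vset_inj on); apply: (imset_inj inj_f).
by rewrite -!gE E.
Qed.

Lemma tree_house_not_unimodular (V : finType) (G : hypergraph V) :
  contains_tree_house G -> ~ unimodular G.
Proof.
move=> [V' [T [/tree_house_std[n [on [v [e [inj_v inj_e ve]]]]]]]].
move=> /containsP[f [g [inj_f inj_g fg]]].
apply: (@kernel_not_unimodular _ _ _ (@house_vset n) (f \o v) (g \o e)).
- exact: inj_comp.
- exact: inj_comp.
- by move=> x y; rewrite /= fg ve mem_imset.
- by apply/card_gt0P; exists None.
- by move=> y; rewrite card_house_vset //; case: y.
- by move=> X; apply: house_kernel.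
Qed.

(** * The model satisfies the definition of a tree house *)

Section StandardHouseIsTreeHouse.

Variable n : 'I_3 -> nat.
Hypothesis odd_n : forall i, odd (n i).

Notation node := (option {i : 'I_3 & 'I_(n i)}).
Notation T := (std_house n).
Notation forest := (@del_hyperedge node T None).

Definition edge_of (u : {i : 'I_3 & 'I_(n i)}) : hyperedge forest :=
  exist (fun y : node => y != None) (Some u) isT.

Lemma edge_ofP (y : hyperedge forest) : exists u, y = edge_of u.
Proof. by case: y => -[u|//] y; exists u; apply: val_inj. Qed.

Lemma vset_edge_of u : vset (edge_of u) = [set parent u; Some u].
Proof. by []. Qed.

(** Every node is connected to the root through its ancestors. In a cycle, both edges at a node of
    greatest depth would be the edge to its parent, but they are distinct. *)
Lemma forest_tree : is_tree forest.
Proof.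
split.
- by move=> y; have [u ->] := edge_ofP y; rewrite vset_edge_of cards2 parent_neq.
- by apply/card_gt0P; exists None.
- have root x : connect (adjacent forest) None x.
    have [d] := ubnP (depth x); elim: d x => // d IH [u|] lt; last exact: connect0.
    apply: connect_trans (IH (parent u) _) (connect1 _).
      by move: lt; rewrite -depth_parent.
    by apply/existsP; exists (edge_of u); rewrite vset_edge_of set21 set22.
  have sym : connect_sym (adjacent forest).
    by apply: sym_connect_sym => x y; apply: eq_existsb => z; rewrite andbC.
  by move=> x y; apply: connect_trans (root y); rewrite sym.
- move=> k V' C [k1 [v [e [bv be ve]]]] /containsP[f [g [inj_f inj_g fg]]].
  have k0 : 0 < k by exact: ltn_trans k1.
  have [i _ max] := @arg_maxnP _ (Ordinal k0) xpredT (fun i => depth (f (v i))) isT.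
  have top j : v i \in vset (e j) -> val (g (e j)) = f (v i).
    move=> ij.
    have [m [mj mi]] : exists m, v m \in vset (e j) /\ f (v m) != f (v i).
      move: ij; rewrite ve !inE => /orP[]/eqP/(bij_inj bv) E.
        exists (ordS j); split; first by rewrite ?inE eqxx orbT.
        by rewrite (inj_eq inj_f) (inj_eq (bij_inj bv)) E eq_sym ordS_neq.
      exists j; split; first by rewrite ?inE eqxx.
      by rewrite (inj_eq inj_f) (inj_eq (bij_inj bv)) E ordS_neq.
    have [u Eu] := edge_ofP (g (e j)).
    move: ij mj; rewrite -!fg Eu vset_edge_of !inE => /orP[/eqP E|/eqP -> //].
    rewrite E in mi *; rewrite (negPf mi) /= => /eqP Em.
    have : depth (f (v m)) <= depth (f (v i)) by exact: max.
    by rewrite Em E -depth_parent ltnn.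
  have E : e i = e (ord_pred i).
    apply/inj_g/val_inj; rewrite !top // ve ?ord_predK !inE eqxx ?orbT //.
  have /(congr1 (@ordS k)) : i = ord_pred i by exact: bij_inj be _ _ E.
  by rewrite ord_predK => /esym/eqP; rewrite (negPf (ordS_neq _ k1)).
Qed.

Definition walk i (k : 'I_(n i).+1) : node :=
  if unlift ord0 k is Some k' then Some (Tagged (fun i => 'I_(n i)) k') else None.

Lemma walk_lift i (k : 'I_(n i)) : walk (lift ord0 k) = Some (Tagged _ k).
Proof. by rewrite /walk liftK. Qed.

Lemma walk0 i : walk (ord0 : 'I_(n i).+1) = None.
Proof. by rewrite /walk unlift_none. Qed.

Lemma walk_inj i : injective (@walk i).
Proof.
move=> k m; case: (unliftP ord0 k) => [k' ->|->]; case: (unliftP ord0 m) => [m' ->|->] //;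
  rewrite ?walk_lift ?walk0 //.
by case=> /eqP; rewrite eq_Tagged => /eqP /= ->.
Qed.

Lemma walk_widen i (k : 'I_(n i)) :
  walk (widen_ord (leqnSn _) k) = parent (Tagged (fun i => 'I_(n i)) k).
Proof.
case: k => [[|m] lt] /=; first by rewrite -(walk0 i); congr walk; exact: val_inj.
by rewrite /Node -walk_lift; congr walk; exact: val_inj.
Qed.

Lemma std_house_tree_house : is_tree_house T.
Proof.
exists None, None, (leaf odd_n), n, walk, (fun i k => edge_of (Tagged _ k)); split.
- rewrite -[vset _]/(house_vset None) -house_hub; split=> //.
  exact: (card_house_vset odd_n None).
- exact: forest_tree.
- move=> i; split=> //; split.
  + exact: walk_inj.
  + exact: walk0.
  + rewrite /leaf /Node -walk_lift; congr walk.
    by apply: val_inj => /=; rewrite /bump add1n prednK ?n_gt0.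
  + by move=> k; rewrite vset_edge_of walk_widen walk_lift.
- split=> [[[i k]|]|y].
  + by exists i, (lift ord0 k); rewrite walk_lift.
  + by exists ord0, ord0; rewrite walk0.
  + by have [[i k] ->] := edge_ofP y; exists i, k.
- move=> i j ij; rewrite -setI_eq0; apply/eqP/setP => x; rewrite !inE.
  apply/negP => /andP[/andP[x0 /imsetP[k _ Ek]] /andP[_ /imsetP[m _ Em]]].
  move: x0 Em; rewrite Ek; case: (unliftP ord0 k) => [k' ->|->]; last by rewrite walk0 eqxx.
  case: (unliftP ord0 m) => [m' ->|->]; last by rewrite walk0 => /eqP.
  rewrite !walk_lift => _ [E _]; by rewrite E eqxx in ij.
Qed.

End StandardHouseIsTreeHouse.

(** * From incidence graphs to subhypergraphs *)

Section IncidenceGraph.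

Variables (V E : finType) (inc : V -> E -> bool).

Definition incidence : rel (V + E) := fun x y =>
  match x, y with
  | inl v, inr e | inr e, inl v => inc v e
  | _, _ => false
  end.

Definition is_vertex : pred (V + E) := fun x => if x is inl _ then true else false.

Lemma incidence_sym : symmetric incidence.
Proof. by move=> [v|e] [v'|e']. Qed.

Lemma incidence_bip x y : incidence x y -> is_vertex x = ~~ is_vertex y.
Proof. by case: x y => [v|e] [v'|e']. Qed.

Let sym := incidence_sym.
Let irr : irreflexive incidence := bip_irr incidence_bip.

Lemma ipath_nth x0 s i j : ipath incidence s -> i < size s -> j < size s ->
  incidence (nth x0 s i) (nth x0 s j) = (j == i.+1) || (i == j.+1).
Proof.
have first x t k : ipath incidence (x :: t) -> k < size t ->
    incidence x (nth x0 t k) = (k == 0).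
  case: t => // y t; rewrite ipath_cons => /and3P[xy /anti1P xt _].
  case: k => [|k] //= kt; apply/negbTE; exact: (xt _ (mem_nth _ kt)).2.
elim: s i j => // x t IH [|i] [|j] ip; rewrite /= ?ltnS => it jt.
- by rewrite irr.
- by rewrite first // eqSS orbF.
- by rewrite sym first // !eqSS.
- by rewrite IH //; exact: (@ipath_catr _ _ [:: x] t ip).
Qed.

Lemma ring_nth x0 z s j : ring incidence z s -> j < size s ->
  incidence z (nth x0 s j) = (j == 0) || (j.+1 == size s).
Proof.
move=> /[dup] /ring_shape[x [m [y ->]]]; rewrite (ringE irr) => /and4P[_ zx zy /anti1P zm].
rewrite /= size_rcons; case: j => [|j] /=; first by rewrite zx.
rewrite ltnS nth_rcons !eqSS => jm.
case: (ltngtP j (size m)) jm => [jm _|lt jm|_ _]; last by rewrite zy.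
  by apply/negbTE; exact: (zm _ (mem_nth _ jm)).2.
by rewrite ltnS leqNgt lt in jm.
Qed.

Lemma path_side x0 x s i : path incidence x s -> i <= size s ->
  is_vertex (nth x0 (x :: s) i) = is_vertex x (+) odd i.
Proof.
elim: s x i => [|y s IH] x [|i] //=; rewrite ?addbF // => /andP[/incidence_bip -> ps] le.
by rewrite (IH y i ps le); case: is_vertex; case: odd.
Qed.

Definition vertex_of (v0 : V) (x : V + E) : V := if x is inl v then v else v0.
Definition edge_at (e0 : E) (x : V + E) : E := if x is inr e then e else e0.

Lemma vertex_ofK v0 x : is_vertex x -> inl (vertex_of v0 x) = x.
Proof. by case: x. Qed.

Lemma edge_atK e0 x : ~~ is_vertex x -> inr (edge_at e0 x) = x.
Proof. by case: x. Qed.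

(** Rotated to start at a vertex, the hole has vertices at even and hyperedges at odd positions. Its
    length is 2 modulo 4, so its number [n] of vertices is odd. *)
Lemma odd_hole_embedding : odd_hole incidence ->
  exists n (v : 'I_n -> V) (e : 'I_n -> E), [/\ odd n, 1 < n, injective v, injective e
    & forall i j, inc (v i) (e j) = (i \in cycle_vset j)].
Proof.
move=> [z [s [r s1]]].
have {r s1 z s} [v0 [s [r s1]]] : exists v0 s, ring incidence (inl v0) s /\ size s %% 4 = 1.
  case: z r => [v0|e0] r; first by exists v0, s.
  have [x [m [y Es]]] := ring_shape r.
  have [v0 Ex] : exists v0, x = inl v0.
    move: r; rewrite Es (ringE irr) => /and4P[_ + _ _].
    by case: x {Es} => [v0|//] _; exists v0.
  exists v0, (rcons (rcons m y) (inr e0)); split; last first.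
    by move: s1; rewrite Es /= !size_rcons.
  by rewrite -Ex; apply: (ring_rot1 sym irr); rewrite -Es.
pose z : V + E := inl v0.
have [x [m [y Es]]] := ring_shape r.
have [zx us pzs] : [/\ incidence z x, uniq (z :: s) & path incidence z s].
  have [ips zs _] := and3P r; rewrite cons_uniq zs (ipath_uniq irr ips).
  move: r ips; rewrite Es (ringE irr) => /and4P[_ zx _ _] ips.
  by split=> //; apply/andP; split=> //; exact: (ipath_path ips).
have [e0 Ex] : exists e0, x = inr e0 by case: x zx {Es} => // e0; exists e0.
pose n := (size s).+1./2.
have sn : (size s).+1 = 2 * n.
  by rewrite mul2n /n; apply/esym/even_halfK; move: s1; clear; lia.
have ps : 1 < size s by rewrite Es /= size_rcons.
have n1 : 1 < n by move: ps s1 sn; clear; lia.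
pose c := z :: s.
pose v (i : 'I_n) := vertex_of v0 (nth z c (2 * i)).
pose e (i : 'I_n) := edge_at e0 (nth z c (2 * i).+1).
have sz (i : 'I_n) : (2 * i).+1 <= size s.
  by rewrite -ltnS sn; have := ltn_ord i; clear; lia.
have vE (i : 'I_n) : inl (v i) = nth z c (2 * i).
  apply: vertex_ofK; rewrite path_side //.
    by rewrite mul2n odd_double.
  exact: ltnW (sz i).
have eE (i : 'I_n) : inr (e i) = nth z c (2 * i).+1.
  by apply: edge_atK; rewrite path_side ?sz // [odd _]/= mul2n odd_double.
have inj_c i j : i < size c -> j < size c -> nth z c i = nth z c j -> i = j.
  by move=> ic jc /eqP; rewrite nth_uniq // => /eqP.
have szc : size c = 2 * n by rewrite /= sn.
exists n, v, e; split=> //.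
- by move: s1 sn; clear; lia.
- move=> i j /(congr1 (@inl V E)); rewrite !vE => /inj_c E'; apply: val_inj => /=.
  have := ltn_ord i; have := ltn_ord j; move: E'; rewrite szc; clear; lia.
- move=> i j /(congr1 (@inr V E)); rewrite !eE => /inj_c E'; apply: val_inj => /=.
  have := ltn_ord i; have := ltn_ord j; move: E'; rewrite szc; clear; lia.
move=> i j; rewrite -[LHS]/(incidence (inl (v i)) (inr (e j))) vE eE.
rewrite !inE -!val_eqE /=; have := ltn_ord i; have := ltn_ord j => jn im.
have [ips _ _] := and3P r.
have js : 2 * j < size s by move: sn jn; clear; lia.
(* The incidences of the first vertex, including the one that closes the cycle, come from
   [ring_nth]; all others are between positions of the induced path [s]. *)
have [i0|i0] := posnP i.
  have -> : nth z c (2 * i) = z by rewrite i0.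
  rewrite (ring_nth z r js) i0.
  have [E'|lt] := eqVneq j.+1 n.
    by rewrite E' modnn eqxx orbT; move: sn E'; clear; lia.
  rewrite modn_small; last by rewrite ltn_neqAle lt.
  by move: sn lt; clear; lia.
have is1 : (2 * i.-1).+1 < size s.
  by move: (sz (Ordinal im)) i0; rewrite [nat_of_ord (Ordinal im)]/=; clear; lia.
have -> : nth z c (2 * i) = nth z s (2 * i.-1).+1 by rewrite -{1}(prednK i0) mulnS.
rewrite (ipath_nth z ips is1 js).
have [E'|lt] := eqVneq j.+1 n.
  by rewrite E' modnn; move: i0 im E'; clear; lia.
rewrite modn_small; last by rewrite ltn_neqAle lt.
by move: i0; clear; lia.
Qed.

Lemma house_vset_tag (n : 'I_3 -> nat) (u w : {i : 'I_3 & 'I_(n i)}) :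
  Some u \in house_vset (Some w) -> tag u = tag w.
Proof.
rewrite !inE => /orP[]/eqP; last by case=> ->.
by case: w => j [[|m] lt] //= [->].
Qed.

Lemma house_vset_same (n : 'I_3 -> nat) i (k m : 'I_(n i)) :
  (Node k \in house_vset (Node m)) = (m == k :> nat) || (m == k.+1 :> nat).
Proof.
have NodeE (k' m' : 'I_(n i)) : (Node k' == Node m') = (m' == k' :> nat).
  by rewrite [LHS]/(_ == _) /= eq_Tagged /= eq_sym.
rewrite {2}/Node /house_vset !inE orbC; congr (_ || _); first exact: NodeE.
case: m => [[|m] lt] //=; rewrite NodeE //=.
Qed.

Lemma house_vset_root (n : 'I_3 -> nat) i (m : 'I_(n i)) :
  (None \in house_vset (Node m)) = (m == 0 :> nat).
Proof. by rewrite !inE orbF; case: m => [[|m] lt]. Qed.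

(** The root is not counted in a leg, so hyperedge [k] is at position [2 * k] and vertex [k] at
    [2 * k + 1]. The length of a leg is 2 modulo 4, so [n i] is odd. *)
Lemma tree_house_embedding : tree_house is_vertex incidence ->
  exists n : 'I_3 -> nat, (forall i, odd (n i)) /\
  exists (f : option {i : 'I_3 & 'I_(n i)} -> V) (g : option {i : 'I_3 & 'I_(n i)} -> E),
    [/\ injective f, injective g & forall x y, inc (f x) (g y) = (x \in house_vset y)].
Proof.
move=> [g [r [q1 [q2 [q3 /and5P[/and3P[sg gr _] L1 L2 L3 /and3P[A12 A13 A23]]]]]]].
have [g0 Eg] : exists g0, g = inr g0 by case: g sg {gr L1 L2 L3} => // e _; exists e.
have [r0 Er] : exists r0, r = inl r0.
  by move: gr; rewrite Eg; case: (r) => // v _; exists v.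
pose q (i : 'I_3) := nth [::] [:: q1; q2; q3] i.
have L i : leg incidence g r (q i) by case: i => -[|[|[|]]].
have A i j : i != j -> anti incidence (q i) (q j).
  by case: i j => -[|[|[|//]]] ? [[|[|[|//]]] ?] // _; rewrite /q //= (antiC sym).
pose n i := (size (q i))./2.
have sq i : size (q i) = 2 * n i.
  by have /and4P[_ _ _] := L i; rewrite /n; clear; lia.
have ip i : ipath incidence (r :: q i) by case/and4P: (L i).
have rv : is_vertex r by rewrite Er.
have uq i : uniq (r :: q i) by exact: (ipath_uniq irr (ip i)).
have uqi i : uniq (q i) by case/andP: (uq i).
have vlt i (k : 'I_(n i)) : (2 * k).+1 < size (q i).
  by rewrite sq; have := ltn_ord k; clear; lia.
pose v i (k : 'I_(n i)) := vertex_of r0 (nth r (q i) (2 * k).+1).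
pose e i (k : 'I_(n i)) := edge_at g0 (nth r (q i) (2 * k)).
have vE i (k : 'I_(n i)) : inl (v i k) = nth r (q i) (2 * k).+1.
  apply: vertex_ofK; rewrite -[nth _ _ _]/(nth r (r :: q i) (2 * k).+2).
  by rewrite path_side ?vlt ?(ipath_path (ip i)) // rv /= mul2n odd_double.
have eE i (k : 'I_(n i)) : inr (e i k) = nth r (q i) (2 * k).
  apply: edge_atK; rewrite -[nth _ _ _]/(nth r (r :: q i) (2 * k).+1).
  by rewrite path_side ?(ltnW (vlt _ _)) ?(ipath_path (ip i)) // rv /= mul2n odd_double.
have vq i (k : 'I_(n i)) : inl (v i k) \in q i by rewrite vE mem_nth.
have eq_ i (k : 'I_(n i)) : inr (e i k) \in q i by rewrite eE mem_nth // ltnW.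
have rq i : r \notin q i by case/andP: (uq i).
have gq i : g \notin q i by case/and4P: (L i).
pose F (x : option {i : 'I_3 & 'I_(n i)}) := if x is Some u then v (tag u) (tagged u) else r0.
pose G (x : option {i : 'I_3 & 'I_(n i)}) := if x is Some u then e (tag u) (tagged u) else g0.
exists n; split; first by move=> i; have /and4P[_ _ _] := L i; rewrite /n; clear; lia.
have inj_q i a b : a < size (q i) -> b < size (q i) -> nth r (q i) a = nth r (q i) b -> a = b.
  by move=> al bl /eqP; rewrite nth_uniq ?uqi // => /eqP.
exists F, G; split.
- move=> [[i k]|] [[j m]|] //= E'.
  + have [ij|ij] := eqVneq i j.
      subst j; move: (congr1 (@inl V E) E'); rewrite !vE => /inj_q.
      move=> /(_ (vlt _ _) (vlt _ _)) Ekm.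
      by have -> : k = m by apply: val_inj; move: Ekm; rewrite /=; clear; lia.
    have /antiP/(_ _ _ (vq i k) (vq j m)) := A i j ij.
    by rewrite E' eqxx => -[].
  + by have := rq i; rewrite Er -E' vq.
  + by have := rq j; rewrite Er E' vq.
- move=> [[i k]|] [[j m]|] //= E'.
  + have [ij|ij] := eqVneq i j.
      subst j; move: (congr1 (@inr V E) E'); rewrite !eE => /inj_q.
      move=> /(_ (ltnW (vlt _ _)) (ltnW (vlt _ _))) Ekm.
      by have -> : k = m by apply: val_inj; move: Ekm; rewrite /=; clear; lia.
    have /antiP/(_ _ _ (eq_ i k) (eq_ j m)) := A i j ij.
    by rewrite E' eqxx => -[].
  + by have := gq i; rewrite Eg -E' eq_.
  + by have := gq j; rewrite Eg E' eq_.
move=> x y; rewrite -[LHS]/(incidence (inl (F x)) (inr (G y))).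
case: x y => [[i k]|] [[j m]|].
- rewrite -[LHS]/(incidence (inl (v i k)) (inr (e j m))).
  have [ij|ij] := eqVneq i j; last first.
    have /antiP/(_ _ _ (vq i k) (eq_ j m))[_ /negbTE ->] := A i j ij.
    apply/esym/negbTE/negP => H; have /= E' := house_vset_tag H.
    by rewrite E' eqxx in ij.
  subst j; rewrite vE eE.
  rewrite -[nth _ _ (_).+1]/(nth r (r :: q i) (2 * k).+2).
  rewrite -[X in incidence _ X]/(nth r (r :: q i) (2 * m).+1).
  rewrite (ipath_nth r (ip i)) ?ltnS ?vlt //; last exact: ltnW.
  rewrite [RHS]house_vset_same; clear; lia.
- rewrite -[LHS]/(incidence (inl (v i k)) (inr g0)) -Eg sym vE inE /=.
  have -> : incidence g (nth r (q i) (2 * k).+1) = (nth r (q i) (2 * k).+1 == last g (q i)).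
    have /and4P[_ _ /eqP Fl _] := L i.
    by rewrite -(mem_seq1 _ (last _ _)) -Fl mem_filter mem_nth ?andbT.
  rewrite (_ : last g (q i) = nth r (q i) (size (q i)).-1); last first.
    by rewrite nth_last; case: (q i) (vlt i k).
  have l1 : (size (q i)).-1 < size (q i) by case: (q i) (vlt i k).
  rewrite nth_uniq ?uqi // sq.
  by have := ltn_ord k; clear; lia.
- rewrite -[LHS]/(incidence (inl r0) (inr (e j m))) -Er eE [RHS]house_vset_root.
  rewrite -[r in incidence r]/(nth r (r :: q j) 0).
  rewrite -[nth _ (q j) _]/(nth r (r :: q j) (2 * m).+1).
  rewrite (ipath_nth r (ip j)) //; last by rewrite ltnS ltnW.
  by clear; lia.
- by rewrite -[LHS]/(incidence (inl r0) (inr g0)) -Er -Eg sym gr inE.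
Qed.

End IncidenceGraph.

(** * Submatrices with even row and column sums *)

Section Submatrix.

Variables (V A B : finType) (G : hypergraph V) (f : A -> V) (g : B -> hyperedge G).
Hypotheses (inj_f : injective f) (inj_g : injective g).

Let b (x : A) (y : B) : bool := f x \in vset (g y).

Lemma odd_hole_contains : odd_hole (incidence b) -> contains_odd_cycle G.
Proof.
move=> /odd_hole_embedding[n [v [e [on n1 inj_v inj_e H]]]].
exists 'I_n, (std_cycle n); split; first by exists n => //; exact: std_cycleP.
by apply/containsP; exists (f \o v), (g \o e); split=> //; exact: inj_comp.
Qed.

Lemma tree_house_contains :
  tree_house (@is_vertex A B) (incidence b) -> contains_tree_house G.
Proof.
move=> /tree_house_embedding[n [on [v [e [inj_v inj_e H]]]]].
exists _, (std_house n); split; first exact: std_house_tree_house.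
by apply/containsP; exists (f \o v), (g \o e); split=> //; exact: inj_comp.
Qed.

Lemma degree_vertex (x : A) : #|incidence b (inl x)| = \sum_y (b x y : nat).
Proof. by rewrite card_sum big_sumType /= big1. Qed.

Lemma degree_edge (y : B) : #|incidence b (inr y)| = \sum_x (b x y : nat).
Proof. by rewrite card_sum big_sumType /= [X in _ + X]big1 ?addn0. Qed.

(** Hyperedges that are large in the submatrix are thus large in [G], so their disjointness carries
    over. *)
Lemma degree_edge_le (y : B) : #|incidence b (inr y)| <= #|vset (g y)|.
Proof.
rewrite degree_edge -big_mkcond sum1_card -(card_imset _ inj_f).
by apply/subset_leq_card/subsetP => _ /imsetP[x xy ->].
Qed.

Lemma submatrix_bigraph : disjoint_hypergraph G ->
  (forall x, ~~ odd (\sum_y (b x y : nat))) -> (forall y, ~~ odd (\sum_x (b x y : nat))) ->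
  bigraph (@is_vertex A B) (incidence b).
Proof.
move=> disj rows cols; split.
- exact: incidence_sym.
- exact: incidence_bip.
- by case=> [x|y]; rewrite ?degree_vertex ?degree_edge.
- move=> [//|e] [//|e'] [t|//] _ _ ee te te' big_e big_e'.
  have ge : g e != g e' by apply: contraNneq ee => /inj_g ->.
  have le4 y : 3 < #|incidence b (inr y)| -> 4 <= #|vset (g y)|.
    by move=> lt; exact: leq_trans (degree_edge_le y).
  have := disjointFr (disj _ _ ge (le4 _ big_e) (le4 _ big_e')) te.
  by rewrite [_ \in _]te'.
Qed.

(** The degree sum, divisible by 8, counts every incidence twice. *)
Lemma entries_dvd4 : disjoint_hypergraph G -> ~ contains_odd_cycle G -> ~ contains_tree_house G ->
  (forall x, ~~ odd (\sum_y (b x y : nat))) -> (forall y, ~~ odd (\sum_x (b x y : nat))) ->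
  4 %| \sum_x \sum_y (b x y : nat).
Proof.
move=> disj noC noT rows cols.
have := bigraph_dvd8 (submatrix_bigraph disj rows cols) (noC \o odd_hole_contains)
  (noT \o tree_house_contains).
rewrite big_sumType /= (eq_bigr _ (fun x _ => degree_vertex x)).
rewrite [X in addn _ X](eq_bigr _ (fun y _ => degree_edge y)) [X in addn _ X]exchange_big /=.
by rewrite addnn -muln2 (@dvdn_pmul2r 2 4).
Qed.

End Submatrix.

(** Induction on the order supplies the unit minors for Camion's argument, whose conclusion on the
    total contradicts [entries_dvd4]. Orders 0 and 1 are checked directly. *)
Lemma unimodular_sufficient (V : finType) (G : hypergraph V) : disjoint_hypergraph G ->
  ~ contains_odd_cycle G -> ~ contains_tree_house G -> unimodular G.
Proof.
move=> disj noC noT k; elim: k => [|k IH] f g inj_f inj_g; first by rewrite det_mx00.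
case: k f g IH inj_f inj_g => [|n] f g IH inj_f inj_g.
  by rewrite det_mx11 !mxE; case: (_ \in _).
set M := mxsub f g _; apply/negPn/negP => detM.
have minors i j : (\det (row' i (col' j M)) \in [:: 0; 1; -1])%R.
  have -> : row' i (col' j M) = mxsub (f \o lift i) (g \o lift j) (incidence_mx G).
    by apply/matrixP => i' j'; rewrite !mxE.
  by apply: IH; apply: inj_comp => //; exact: lift_inj.
pose F := enum_val \o f; pose C := enum_val \o g.
have inj_F : injective F by apply: inj_comp => //; exact: enum_val_inj.
have inj_C : injective C by apply: inj_comp => //; exact: enum_val_inj.
have ME i j : M i j = (F i \in vset (C j))%:R%R by rewrite !mxE.
have rows i : ~~ odd (\sum_j (F i \in vset (C j) : nat)).
  have := row_sum_even minors detM i; rewrite (eq_bigr _ (fun j _ => ME i j)).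
  by rewrite -natr_sum natz dvdzE /= dvdn2.
have cols j : ~~ odd (\sum_i (F i \in vset (C j) : nat)).
  have := col_sum_even minors detM j; rewrite (eq_bigr _ (fun i _ => ME i j)).
  by rewrite -natr_sum natz dvdzE /= dvdn2.
have := total_sum_mod4 minors detM.
rewrite (eq_bigr (fun i => (\sum_j (F i \in vset (C j) : nat))%:R%R)) => [|i _].
  by rewrite -natr_sum natz dvdzE /= (entries_dvd4 inj_F inj_C disj noC noT rows cols).
by rewrite natr_sum; apply: eq_bigr => j _; exact: ME.
Qed.

Theorem theorem1p4 (V : finType) (G : hypergraph V) :
  disjoint_hypergraph G ->
  (unimodular G <-> ~ contains_odd_cycle G /\ ~ contains_tree_house G).
Proof.
move=> disj; split=> [uni|[noC noT]]; last exact: unimodular_sufficient.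
by split=> [/odd_cycle_not_unimodular|/tree_house_not_unimodular].
Qed.
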